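(* Let $1\le m\le n$, and let $p$ be a point in the relative interior of a codimension-$m$ face of a permutohedron in the honeycomb $\mathfrak H_{n-1}\subset V_n$ (i.e. a face of dimension $n-m$). Then a neighborhood of $p$ in $\mathfrak H_{n-1}$ is stratified homeomorphic to the product $\mathbb R^{n-m}\times L_{A_m}$ of $\mathbb R^{n-m}$ with the $A_m$ arboreal singularity.
   Context: $\Lambda_n=\mathbb Z^{n+1}/\mathbb Z\langle\sum_{a=1}^{n+1}\lambda_a\rangle$ with $\lambda_a$ the (images of the) standard basis, $V_n=\Lambda_n\otimes\mathbb R$. The $n$-permutohedron $\mathfrak P_n\subset V_n$ is the convex hull of the orbit of $\frac1{n+1}\sum_{a=1}^{n+1}a\lambda_a$ under the symmetric group $\Sigma_{n+1}$ permuting the $\lambda_a$. Its $\Lambda_n$-translates tile $V_n$, and the honeycomb is $\mathfrak H_{n-1}=\partial\mathfrak P_n+\Lambda_n$, the union of all $\Lambda_n$-translates of $\partial\mathfrak P_n$. It is stratified by the relatively open faces of these polytopes. The (topological) $A_m$ arboreal singularity is $L_{A_m}=\mathrm{Cone}(\mathrm{sk}_{m-2}\Delta^m)$, where $\Delta^m$ is an $m$-simplex with barycenter at the origin, $\mathrm{sk}_{m-2}$ is its $(m-2)$-skeleton, and $\mathrm{Cone}(A)=\mathbb R_{\ge0}\cdot A$ always includes the cone point $0$ (so $L_{A_1}$ is a point). It is stratified by the cone point and the open cones on the open simplices of $\mathrm{sk}_{m-2}\Delta^m$. *)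

(* Defs.v *)
From HB Require Import structures.
From mathcomp Require Import all_boot all_order all_algebra all_fingroup.
From mathcomp Require Import all_classical all_reals all_analysis.

Set Implicit Arguments.
Unset Strict Implicit.
Unset Printing Implicit Defensive.

Import Order.TTheory GRing.Theory Num.Theory.
Import numFieldNormedType.Exports.

Local Open Scope classical_set_scope.
Local Open Scope ring_scope.

Section Convexity.
Variables (R : realType) (n : nat).
Local Notation V := 'rV[R]_n.
Implicit Types (X P F : set V).

Definition conv_hull X : set V := smallest (@convex_set R V) X.

Definition affine_set X :=
  forall (x y : V) (t : R), X x -> X y -> X ((1 - t) *: x + t *: y).

Definition aff_hull X : set V := smallest affine_set X.

(* The empty set has no dimension: no [d] satisfies [aff_dim set0 d]. *)
Definition aff_dim X (d : nat) :=
  exists (x0 : V) (W : {vspace V}),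
    \dim W = d /\ aff_hull X = [set x0 + w | w in [set w | w \in W]].

Definition relint X : set V :=
  [set x | X x /\ within (aff_hull X) (nbhs x) X].

Definition boundary X : set V := closure X `\` X°.

Definition translate (l : V) X : set V := [set l + x | x in X].

(* Faces are cut out by valid linear inequalities; [l = 0] gives the improper
   faces [P] (for [b = 0]) and [set0] (for [b > 0]). *)
Definition is_face P F :=
  exists (l : {scalar V}) (b : R),
    (forall x, P x -> l x <= b) /\ F = [set x | P x /\ l x = b].

End Convexity.

Section Permutohedron.
Variables (R : realType) (n : nat).

(* [V_n], the quotient of [R^(n+1)] by the line spanned by [(1, ..., 1)], is
   identified with [R^n] by the surjection below, whose kernel is that line
   ([quot_diag_surj], [quot_diag_ker]).  In the resulting coordinates
   [lam 0, ..., lam (n-1)] is the standard basis and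
   [lam n = (-1, ..., -1)]. *)
Definition quot_diag (v : 'rV[R]_n.+1) : 'rV[R]_n :=
  \row_(j < n) (v 0 (widen_ord (leqnSn n) j) - v 0 ord_max).

Lemma quot_diag_ker v :
  quot_diag v = 0 <-> exists c : R, v = const_mx c.
Proof.
split=> [v0|[c ->]]; last by apply/rowP => j; rewrite !mxE subrr.
exists (v 0 ord_max); apply/rowP => j; rewrite [RHS]mxE.
case: (unliftP ord_max j) => [i ->|-> //].
have /rowP /(_ i) := v0; rewrite !mxE => /eqP; rewrite subr_eq0 => /eqP <-.
by congr (v _ _); apply/val_inj; rewrite /= /bump leqNgt ltn_ord.
Qed.

Lemma quot_diag_surj x : exists v, quot_diag v = x.
Proof.
exists (\row_(a < n.+1) if unlift ord_max a is Some j then x 0 j else 0).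
apply/rowP => j; rewrite !mxE unlift_none subr0.
have -> : widen_ord (leqnSn n) j = lift ord_max j.
  by apply/val_inj; rewrite /= /bump leqNgt ltn_ord.
by rewrite liftK.
Qed.

Definition lam (a : 'I_n.+1) : 'rV[R]_n := quot_diag (delta_mx 0 a).

Definition Lambda : set 'rV[R]_n :=
  [set \sum_(a < n.+1) (z a)%:~R *: lam a | z in [set: 'I_n.+1 -> int]].

(* Indices start at [0], hence the coefficients [a.+1]. *)
Definition permutohedron : set 'rV[R]_n :=
  conv_hull [set n.+1%:R^-1 *: (\sum_(a < n.+1) a.+1%:R *: lam (s a))
            | s in [set: {perm 'I_n.+1}]].

Definition honeycomb : set 'rV[R]_n :=
  \bigcup_(l in Lambda) translate l (boundary permutohedron).

Definition honeycomb_face (F : set 'rV[R]_n) :=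
  exists2 l, Lambda l &
    [/\ is_face (translate l permutohedron) F, F !=set0 &
        F <> translate l permutohedron].

Definition honeycomb_strata : set (set 'rV[R]_n) :=
  [set relint F | F in honeycomb_face].

End Permutohedron.

Arguments Lambda R n : clear implicits.
Arguments permutohedron R n : clear implicits.
Arguments honeycomb R n : clear implicits.
Arguments honeycomb_strata R n : clear implicits.

Section Simplex.
Variables (R : realType) (d k : nat).
Implicit Types (w : 'I_k.+1 -> 'rV[R]_d) (I : {set 'I_k.+1}).

Definition affinely_independent w :=
  forall c : 'I_k.+1 -> R,
    \sum_i c i = 0 -> \sum_i c i *: w i = 0 -> forall i, c i = 0.

Definition barycenter w : 'rV[R]_d := k.+1%:R^-1 *: \sum_i w i.

(* The face with vertex set [I] has dimension [#|I| - 1].  The bound [e] on the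
   dimension is an integer because the [(-1)]-skeleton, which is empty, is
   needed. *)
Definition skel_index (e : int) : set {set 'I_k.+1} :=
  [set I | (0 < #|I|)%N /\ #|I|%:Z - 1 <= e].

Definition skeleton w (e : int) : set 'rV[R]_d :=
  \bigcup_(I in skel_index e) conv_hull [set w i | i in [set i | i \in I]].

Definition open_simplex w I : set 'rV[R]_d :=
  [set \sum_(i in I) c i *: w i
  | c in [set c : 'I_k.+1 -> R |
           (forall i, i \in I -> 0 < c i) /\ \sum_(i in I) c i = 1]].

End Simplex.

Section Arboreal.
Variables (R : realType) (m : nat).
Implicit Types (A : set 'rV[R]_m) (w : 'I_m.+1 -> 'rV[R]_m).

Definition cone A : set 'rV[R]_m :=
  [set 0] `|` [set t *: x | t in [set t : R | 0 <= t] & x in A].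

Definition open_cone A : set 'rV[R]_m :=
  [set t *: x | t in [set t : R | 0 < t] & x in A].

(* [w] lists the vertices of the [m]-simplex. *)
Definition arboreal w : set 'rV[R]_m := cone (skeleton w (m%:Z - 2)).

Definition arboreal_strata w : set (set 'rV[R]_m) :=
  [set [set 0]] `|`
  [set open_cone (open_simplex w I) | I in skel_index (m%:Z - 2)].

End Arboreal.

(* A stratified space is a subset together with the set of its strata. *)
Definition restrict_strata (X : Type) (S : set (set X)) (U : set X) :
    set (set X) :=
  [set T `&` U | T in [set T | S T /\ T `&` U !=set0]].

Definition stratified_homeomorphic (X Y : topologicalType)
    (A : set X) (SA : set (set X)) (B : set Y) (SB : set (set Y)) :=
  exists (f : X -> Y) (g : Y -> X),
    [/\ set_bij A B f, {in A, cancel f g},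
        {within A, continuous f}, {within B, continuous g} &
        [set f @` T | T in SA] = SB].

(* Main.v *)
(** With the quadratic form q(v) = sum_a v_a^2 - (sum_a v_a)^2 / (n+1) on V_n,
    the permutohedron is the Voronoi cell of 0 for the lattice Lambda, and the
    facets correspond to the vectors v_S = sum_(a in S) lambda_a with S proper
    and nonempty.  Hence the stratum of x in the honeycomb is determined by the
    set of cells containing x, that is, by the lattice points nearest to x.
    On a face of codimension m the tight sets form a chain of length m
    (submodularity), so m + 1 cells meet at p, and near p membership in these
    cells means minimality among m + 1 functions u_0, ..., u_m that become
    linear, with rank m, after subtraction of a common term.  As the vertices
    w_j of the simplex sum to 0 and are affinely independent, sum_j u_j w_j
    depends exactly on the u_j modulo constants, and it lies in the arboreal
    cone iff the minimum of u is attained at least twice, the stratum being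
    given by the set of minimizers.  Thus x |-> sum_j u_j(x - p) w_j, completed
    to a linear isomorphism, straightens the honeycomb near p, and a radial
    rescaling turns a ball into the whole space. *)
Require Import Defs.
From HB Require Import structures.
From mathcomp Require Import all_boot all_order all_algebra all_fingroup.
From mathcomp Require Import all_classical all_reals all_analysis.
From mathcomp Require Import lra zify.
Import Order.TTheory GRing.Theory Num.Theory.
Import numFieldNormedType.Exports.
Local Open Scope classical_set_scope.
Local Open Scope ring_scope.

Set Implicit Arguments.
Unset Strict Implicit.
Unset Printing Implicit Defensive.

(** * Facet functionals of the permutohedron *)

Section CenteredCoordinates.
Variables (R : realType) (n : nat).
Implicit Types (c : 'I_n.+1 -> R) (x y : 'rV[R]_n) (S T : {set 'I_n.+1}).

(* The class of [c] in [V_n], that is, [\sum_a c a *: lam a]. *)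
Definition qd c : 'rV[R]_n := quot_diag (\row_a c a).

Lemma qdE c j : qd c 0 j = c (lift ord_max j) - c ord_max.
Proof.
rewrite !mxE; congr (c _ - _).
by apply/val_inj; rewrite /= /bump leqNgt ltn_ord.
Qed.

Lemma qdD c d : qd (fun a => c a + d a) = qd c + qd d.
Proof. by apply/rowP => j; rewrite [RHS]mxE !qdE; lra. Qed.

Lemma qdZ (k : R) c : qd (fun a => k * c a) = k *: qd c.
Proof. by apply/rowP => j; rewrite [RHS]mxE !qdE; lra. Qed.

Lemma qdN c : qd (fun a => - c a) = - qd c.
Proof. by apply/rowP => j; rewrite [RHS]mxE !qdE; lra. Qed.

Lemma qdB c d : qd (fun a => c a - d a) = qd c - qd d.
Proof. by rewrite qdD qdN. Qed.

Lemma eq_qd c d : c =1 d -> qd c = qd d.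
Proof. by move=> cd; apply/rowP => j; rewrite !qdE !cd. Qed.

Lemma qd_const (k : R) : qd (fun=> k) = 0.
Proof. by apply/rowP => j; rewrite qdE mxE subrr. Qed.

Lemma sum_lam c : \sum_a c a *: @lam R n a = qd c.
Proof.
apply/rowP => j; rewrite summxE qdE.
under eq_bigr => a _.
  rewrite mxE /lam -[delta_mx 0 a](_ : \row_b (b == a)%:R = _); last first.
    by apply/rowP => b; rewrite !mxE.
  rewrite -/(qd (fun b => (b == a)%:R)) qdE mulrBr.
  over.
rewrite sumrB (bigD1 (lift ord_max j)) //= eqxx mulr1 big1 ?addr0; last first.
  by move=> i /negbTE; rewrite eq_sym => ->; rewrite mulr0.
rewrite (bigD1 ord_max) //= eqxx mulr1 big1 ?addr0 //.
by move=> i /negbTE; rewrite eq_sym => ->; rewrite mulr0.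
Qed.

Definition ext0 x (a : 'I_n.+1) : R :=
  if unlift ord_max a is Some j then x 0 j else 0.

(* The coordinates of the representative of [x] with coordinate sum 0. *)
Definition ccoord x (a : 'I_n.+1) : R :=
  ext0 x a - (\sum_b ext0 x b) / n.+1%:R.

Lemma ccoord_qd c a : ccoord (qd c) a = c a - (\sum_b c b) / n.+1%:R.
Proof.
have E b : ext0 (qd c) b = c b - c ord_max.
  rewrite /ext0; case: unliftP => [j ->|->]; last by rewrite subrr.
  by rewrite qdE.
rewrite /ccoord E; under eq_bigr => b _ do rewrite E.
rewrite sumrB sumr_const cardT size_enum_ord mulrBl.
by rewrite -[c ord_max *+ _]mulr_natr mulfK ?pnatr_eq0 // opprB addrA subrK.
Qed.

Lemma qd_ccoord x : qd (ccoord x) = x.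
Proof.
rewrite /ccoord qdB qd_const subr0; apply/rowP => j.
by rewrite qdE /ext0 liftK unlift_none subr0.
Qed.

Lemma sum_ccoord x : \sum_a ccoord x a = 0.
Proof.
rewrite sumrB sumr_const cardT size_enum_ord -[_ / _ *+ _]mulr_natr.
by rewrite mulfVK ?subrr // pnatr_eq0.
Qed.

Lemma ccoord_is_linear k x y a :
  ccoord (k *: x + y) a = k * ccoord x a + ccoord y a.
Proof.
have E b : ext0 (k *: x + y) b = k * ext0 x b + ext0 y b.
  by rewrite /ext0; case: unliftP => [j _|_]; rewrite ?mxE // mulr0 addr0.
rewrite /ccoord E; under eq_bigr => b _ do rewrite E.
by rewrite big_split -mulr_sumr /=; move: (n.+1%:R^-1 : R) => q; lra.
Qed.

(* [hgt S x] is the inner product of [x] with [v_S] for the form q, and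
   [hbound S], defined below, is [q(v_S) / 2]: the facet inequality indexed by
   [S] is [hgt S x <= hbound S]. *)
Definition hgt S x : R := \sum_(a in S) ccoord x a.

Lemma hgt_is_linear S : linear_for *%R (hgt S).
Proof.
move=> k x y; rewrite /hgt mulr_sumr -big_split /=.
by apply: eq_bigr => a _; exact: ccoord_is_linear.
Qed.

HB.instance Definition _ S :=
  GRing.isLinear.Build R 'rV[R]_n R *%R (hgt S) (hgt_is_linear S).

Lemma hgt_qd S c :
  hgt S (qd c) = \sum_(a in S) c a - #|S|%:R * (\sum_b c b) / n.+1%:R.
Proof.
rewrite /hgt; under eq_bigr => a _ do rewrite ccoord_qd.
by rewrite sumrB sumr_const -[_ / _ *+ _]mulr_natl mulrA.
Qed.

Lemma hgt0 x : hgt finset.set0 x = 0.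
Proof. by rewrite /hgt big_set0. Qed.

Lemma hgtT x : hgt [set: 'I_n.+1]%SET x = 0.
Proof. by rewrite -(sum_ccoord x); apply: eq_bigl => a; rewrite inE. Qed.

Lemma hgtC S x : hgt (~: S) x = - hgt S x.
Proof.
apply/eqP; rewrite -addr_eq0 addrC -(sum_ccoord x).
rewrite (bigID [in S]) /=; apply/eqP; congr (_ + _).
by apply: eq_bigl => a; rewrite inE.
Qed.

Lemma hgt_modular S T x :
  hgt S x + hgt T x = hgt (S :|: T) x + hgt (S :&: T) x.
Proof.
rewrite /hgt ![\sum_(a in _) _]big_mkcond -!big_split /=.
apply: eq_bigr => a _; rewrite !inE.
by case: (a \in S); case: (a \in T); rewrite /= ?addr0 ?add0r.
Qed.

Definition vecS S : 'rV[R]_n := qd (fun a => (a \in S)%:R).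

Lemma hgt_vecS S T :
  hgt T (vecS S) = #|T :&: S|%:R - #|T|%:R * #|S|%:R / n.+1%:R.
Proof.
rewrite hgt_qd; congr (_ - _ * _ / _).
  rewrite -sumr_const big_mkcond [RHS]big_mkcond /=.
  by apply: eq_bigr => a _; rewrite inE; case: (a \in T); case: (a \in S).
by rewrite -sumr_const [RHS]big_mkcond /=; apply: eq_bigr => a _; case: (a \in S).
Qed.

Lemma vecS0 : vecS finset.set0 = 0.
Proof. by rewrite -[RHS](qd_const 0); apply: eq_qd => a; rewrite inE. Qed.

(** The hypothesis says that the indicators satisfy the same relation up to an additive constant,
    and constants pair to 0 with the centered coordinates of [x]. *)
Lemma hgt_vecS_lin S1 S2 S3 x :
  vecS S1 + vecS S2 = vecS S3 -> hgt S1 x + hgt S2 x = hgt S3 x.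
Proof.
rewrite /vecS -qdD => E.
pose mean (d : 'I_n.+1 -> R) := (\sum_b d b) / n.+1%:R : R.
have {}E a : (a \in S1)%:R + (a \in S2)%:R = (a \in S3)%:R +
    (mean (fun a : 'I_n.+1 => (a \in S1)%:R + (a \in S2)%:R) -
     mean (fun a : 'I_n.+1 => (a \in S3)%:R)).
  have := congr1 (fun y => ccoord y a) E; rewrite !ccoord_qd /mean /=.
  by move: (_ / _) (_ / _) => p q H; lra.
move: (_ - _) E => k E.
rewrite /hgt ![\sum_(a in _) _]big_mkcond -!big_split /=.
have -> : \sum_a (if a \in S3 then ccoord x a else 0) =
  \sum_a ((if a \in S3 then ccoord x a else 0) + k * ccoord x a).
  by rewrite big_split -mulr_sumr sum_ccoord /= mulr0 addr0.
apply: eq_bigr => a _; have := E a.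
case: (a \in S1); case: (a \in S2); case: (a \in S3) => /= H; nra.
Qed.

Definition hbound S : R := #|S|%:R * (n.+1%:R - #|S|%:R) / (2 * n.+1%:R).

Lemma hbound0 : hbound finset.set0 = 0.
Proof. by rewrite /hbound cards0 !mul0r. Qed.

Lemma hboundT : hbound [set: 'I_n.+1]%SET = 0.
Proof. by rewrite /hbound cardsT card_ord subrr mulr0 mul0r. Qed.

Lemma hboundC S : hbound (~: S) = hbound S.
Proof.
rewrite /hbound; have /(congr1 (fun k => k%:R : R)) := cardsC S.
rewrite natrD card_ord => <-; congr (_ / _); nra.
Qed.

Lemma hgt_vecS_hbound S : hgt S (vecS S) = 2 * hbound S.
Proof.
have N0 : n.+1%:R != 0 :> R by rewrite pnatr_eq0.
rewrite hgt_vecS finset.setIid /hbound invfM.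
have := mulfV N0; have : (2:R) * 2^-1 = 1 by rewrite mulfV // pnatr_eq0.
move: (2^-1 : R) (n.+1%:R^-1 : R) => t q tq Nq.
have -> : 2 * (#|S|%:R * (n.+1%:R - #|S|%:R) * (t * q)) =
  (2 * t) * (#|S|%:R * ((n.+1%:R * q) - #|S|%:R * q)) by lra.
by rewrite tq Nq; lra.
Qed.

Lemma cardR_setID S T : #|S|%:R = #|S :&: T|%:R + #|S :\: T|%:R :> R.
Proof. by rewrite -natrD cardsID. Qed.

Lemma cardR_setU S T :
  #|S :|: T|%:R = #|S :&: T|%:R + #|S :\: T|%:R + #|T :\: S|%:R :> R.
Proof.
rewrite (cardR_setID (S :|: T) S).
have -> : (S :|: T) :&: S = S.
  by apply/setP => a; rewrite !inE; case: (a \in S); rewrite ?andbF.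
have -> : (S :|: T) :\: S = T :\: S.
  by apply/setP => a; rewrite !inE; case: (a \in S).
by rewrite (cardR_setID S T).
Qed.

(** The correction term vanishes exactly when [S] and [T] are nested, so equality in submodularity
    detects chains. *)
Lemma hbound_modular S T :
  hbound S + hbound T = hbound (S :|: T) + hbound (S :&: T)
                  + #|S :\: T|%:R * #|T :\: S|%:R / n.+1%:R.
Proof.
have N0 : n.+1%:R != 0 :> R by rewrite pnatr_eq0.
rewrite /hbound cardR_setU (cardR_setID S T) (cardR_setID T S) (finset.setIC T S).
rewrite invfM; have : (2:R) * 2^-1 = 1 by rewrite mulfV // pnatr_eq0.
move: (2^-1 : R) (n.+1%:R^-1 : R) => t q tq.
have -> : #|S :\: T|%:R * #|T :\: S|%:R * q =
  #|S :\: T|%:R * #|T :\: S|%:R * (2 * t) * q :> R by rewrite tq mulr1.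
by lra.
Qed.

Definition proper_set S := (S != finset.set0) && (S != [set: 'I_n.+1]%SET).

Lemma card_proper S : proper_set S -> (0 < #|S| < n.+1)%N.
Proof.
case/andP => S0 ST; rewrite card_gt0 S0 /=.
by rewrite -[X in (_ < X)%N]card_ord -cardsT; apply: proper_card; rewrite properT.
Qed.
End CenteredCoordinates.

Arguments vecS R {n} S.
Arguments hbound R {n} S.

(** * The permutohedron is the Voronoi cell of the lattice *)

Lemma convex_set_combination (R : realType) n (K : set 'rV[R]_n) x y (t : R) :
  @convex_set R 'rV[R]_n K -> K x -> K y -> 0 <= t -> t <= 1 ->
  K (t *: x + (1 - t) *: y).
Proof.
move=> cK Kx Ky t0 t1; have := cK x y (Itv01 t0 t1).
by rewrite !inE; apply.
Qed.

Section PermutohedronInequalities.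
Variables (R : realType) (n : nat).
Implicit Types (x y : 'rV[R]_n) (S T : {set 'I_n.+1}).

(** The improper sets give 0 <= 0; allowing them keeps the family of inequalities closed under
    unions, intersections and complements. *)
Definition polyh : set 'rV[R]_n := [set y | forall S, hgt S y <= hbound R S].

Let N0 : n.+1%:R != 0 :> R. Proof. by rewrite pnatr_eq0. Qed.

(** Heights are modular and bounds are submodular, so the inequalities of the union and the
    intersection have no room left: both are equalities, and the defect is 0. *)
Lemma tight_modular S T y : polyh y -> hgt S y = hbound R S -> hgt T y = hbound R T ->
  [/\ hgt (S :|: T) y = hbound R (S :|: T), hgt (S :&: T) y = hbound R (S :&: T) &
      #|S :\: T|%:R * #|T :\: S|%:R = 0 :> R].
Proof.
move=> Py tS tT; have := hgt_modular S T y; have := hbound_modular R S T.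
have := Py (S :|: T); have := Py (S :&: T).
have e0 : 0 <= #|S :\: T|%:R * #|T :\: S|%:R :> R by rewrite mulr_ge0.
have q0 : 0 < n.+1%:R^-1 :> R by rewrite invr_gt0.
move: (n.+1%:R^-1 : R) q0 (#|S :\: T|%:R * _ : R) e0 => q q0 e e0.
rewrite tS tT => h1 h2 h3 h4.
have eq0 : e * q = 0 by nra.
split; [lra|lra|].
by move/eqP: eq0; rewrite mulf_eq0 (gt_eqF q0) orbF => /eqP.
Qed.

Lemma tight_chain S T y : polyh y -> hgt S y = hbound R S -> hgt T y = hbound R T ->
  (S \subset T) || (T \subset S).
Proof.
move=> Py tS tT; have [_ _ /eqP] := tight_modular Py tS tT.
by rewrite mulf_eq0 !pnatr_eq0 !cards_eq0 !finset.setD_eq0.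
Qed.

(** By submodularity at [S] and [T], the inequality of [T] at the new point reduces to
    [#|S :&: T| * (n + 1 - #|S :|: T|) >= 0]. *)
Lemma polyh_sub_vecS S y : polyh y -> hgt S y = hbound R S -> polyh (y - vecS R S).
Proof.
move=> Py tS T; rewrite linearB /= hgt_vecS.
have := hgt_modular S T y; have := hbound_modular R S T.
have := Py (S :|: T); have := Py (S :&: T).
have := max_card [in S :|: T]; rewrite card_ord -(ler_nat R) cardR_setU.
rewrite (finset.setIC T S) (cardR_setID R S T) (cardR_setID R T S) (finset.setIC T S).
rewrite tS; have := mulfV N0; have q0 : 0 < n.+1%:R^-1 :> R by rewrite invr_gt0.
move: (n.+1%:R^-1 : R) q0 (ler0n R #|S :&: T|) => q q0.
move: (#|S :&: T|%:R : R) (#|S :\: T|%:R : R) (#|T :\: S|%:R : R) => i a b.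
move: (n.+1%:R : R) => N i0 Nq le_N h1 h2 h3 h4.
have : 0 <= i * (q * (N - (i + a + b))) by rewrite !mulr_ge0 ?subr_ge0 // ltW.
have -> : i * (q * (N - (i + a + b))) = i * (N * q) - i * (i + a + b) * q by lra.
by rewrite Nq; lra.
Qed.

(* Let [S] be the set where [z] is maximal.  The inequality of [S] at [y] and
   that of its complement at [y - d] add up to [hgt S d <= 2 * hbound S], which
   forces [z] to be the indicator of [S] up to a constant. *)
Lemma polyh_neighbor (z : 'I_n.+1 -> int) y :
  let d := qd (fun a => (z a)%:~R) : 'rV[R]_n in
  polyh y -> polyh (y - d) -> d <> 0 ->
  exists S, [/\ proper_set S, d = vecS R S & hgt S y = hbound R S].
Proof.
move=> d Py Pyd d0.
case: (@arg_maxP _ _ _ (ord0 : 'I_n.+1) xpredT z isT) => a0 _ zmax.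
pose M := z a0; pose S := [set a | z a == M]%SET.
have S0 : S != finset.set0.
  by apply/finset.set0Pn; exists a0; rewrite inE.
have ST : S != [set: 'I_n.+1]%SET.
  apply/eqP => ST; apply: d0; rewrite -(@qd_const _ _ (M%:~R)).
  by apply: eq_qd => a; have : a \in S by [rewrite ST inE]; rewrite inE => /eqP->.
have pS : proper_set S by rewrite /proper_set S0.
(* The drop of [z] below its maximum, beyond the drop 1 outside [S] of an indicator; integrality of
   [z] makes it nonnegative. *)
pose e a : R := M%:~R - (z a)%:~R - (a \notin S)%:R.
have e0 a : 0 <= e a.
  rewrite /e; have := zmax a isT; rewrite -/M => zM.
  have [/eqP|zM'] := boolP (a \in S).
    by rewrite subr0 subr_ge0 ler_int.
  have : z a + 1 <= M.
    by rewrite -ltzD1 // in zM *; move: zM'; rewrite inE; lia.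
  by rewrite -(ler_int R) intrD /=; lra.
have eS a : a \in S -> e a = 0.
  by move=> aS; rewrite /e aS subr0; move: aS; rewrite inE => /eqP ->; rewrite subrr.
have dE : d = vecS R S - qd e.
  rewrite /d /vecS -qdB -[LHS]subr0 -[X in _ - X](@qd_const _ _ (M%:~R - 1)) -qdB.
  by apply: eq_qd => a; rewrite /e; case: (a \in S) => /=; lra.
have hSe : hgt S (qd e) = - (#|S|%:R * (\sum_b e b) / n.+1%:R).
  by rewrite hgt_qd big1 ?sub0r // => a; exact: eS.
have hS := Py S; have := Pyd (~: S); rewrite hboundC hgtC !linearB /= => hSC.
have hd : hgt S d = 2 * hbound R S + #|S|%:R * (\sum_b e b) / n.+1%:R.
  by rewrite dE linearB /= hgt_vecS_hbound hSe opprK.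
have sum0 : \sum_b e b = 0.
  have s0 : 0 <= \sum_b e b by apply: sumr_ge0.
  have /andP[cS _] := card_proper pS.
  have q0 : 0 < #|S|%:R / n.+1%:R :> R by rewrite divr_gt0 ?ltr0n.
  have : #|S|%:R / n.+1%:R * (\sum_b e b) <= 0.
    by rewrite mulrAC; move: hd; move: (_ / _) => q; lra.
  by rewrite pmulr_rle0 // => s1; apply/eqP; rewrite eq_le s0 s1.
have e00 a : e a = 0.
  apply/eqP; move/eqP: sum0; rewrite psumr_eq0 // => /allP/(_ a).
  by rewrite mem_index_enum => /(_ isT).
exists S; split=> //.
  by rewrite dE (_ : qd e = 0) ?subr0 // -(@qd_const _ _ 0); apply: eq_qd.
by move: hd; rewrite sum0 mulr0 mul0r => hd; lra.
Qed.

(** * The vertices satisfy the facet inequalities *)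

Lemma sum_ord_set_ge m (A : {set 'I_m}) :
  (#|A| * #|A|.-1 <= 2 * \sum_(a in A) a)%N.
Proof.
have [k] := ubnP #|A|; elim: k A => // k IH A.
have [->|/finset.set0Pn[a0 a0A]] := eqVneq A finset.set0; first by rewrite cards0.
rewrite ltnS => cA.
case: (@arg_maxnP _ a0 [in A] (fun a : 'I_m => a : nat) a0A) => a aA amax.
have := cardsD1 a A; rewrite aA (bigD1 a) //= => cE.
have := IH (A :\ a); rewrite (_ : (#|A :\ a| < k)%N); last by move: cA; rewrite cE add1n.
have -> : (\sum_(i in A :\ a) i = \sum_(i in A | i != a) i)%N.
  by apply: eq_bigl => i; rewrite !inE andbC.
move=> /(_ isT); rewrite cE.
(* All other elements of [A] lie below its maximum [a]; removing [a] therefore lowers the sum by at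
   least [#|A| - 1]. *)
have : (#|A :\ a| <= a)%N.
  rewrite -[X in (_ <= X)%N](card_ord a).
  have -> : #|'I_a| = #|[set widen_ord (ltnW (ltn_ord a)) i | i in 'I_a]%SET|.
    by rewrite card_imset // => i j /(congr1 val) /= ij; exact: val_inj.
  apply: subset_leq_card; apply/fintype.subsetP => b; rewrite !inE => /andP[ba bA].
  have lba : (b < a)%N by rewrite ltn_neqAle; apply/andP; split; [exact: ba|exact: amax].
  by apply/imsetP; exists (Ordinal lba) => //; apply: val_inj.
move: (#|_ :\ _|) (\sum_(i in A | _) _)%N => c s; nia.
Qed.

Definition vertex (r : {perm 'I_n.+1}) : 'rV[R]_n :=
  qd (fun a => n.+1%:R^-1 * (r a).+1%:R).

(** The coefficient [a.+1] stands at [s a], so the coordinates are read off through the inverse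
    permutation. *)
Lemma vertexE (s : {perm 'I_n.+1}) :
  n.+1%:R^-1 *: (\sum_(a < n.+1) a.+1%:R *: lam R (s a)) = vertex s^-1%g.
Proof.
rewrite /vertex qdZ; congr (_ *: _).
rewrite (reindex_inj (@perm_inj _ s^-1%g)) /= -sum_lam.
by apply: eq_bigr => a _; rewrite permKV.
Qed.

Lemma sum_succ k : 2 * \sum_(a < k) a.+1%:R = k%:R * (k%:R + 1) :> R.
Proof.
elim: k => [|k IH]; first by rewrite big_ord0 mulr0 mul0r.
by rewrite big_ord_recr mulrDr IH /= -[k.+1%:R]natr1; lra.
Qed.

Lemma polyh_vertex r : polyh (vertex r).
Proof.
(* Passing to the complement turns the upper bound into a lower bound on a sum of distinct ranks. *)
move=> S; rewrite -[S]finset.setCK hboundC hgtC lerNl; move: (~: S) => {}S.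
have := @sum_ord_set_ge _ (r @: S)%SET.
rewrite card_imset; last exact: perm_inj.
rewrite big_imset /=; last by move=> ? ? _ _; exact: perm_inj.
rewrite -(ler_nat R) !natrM natr_sum /vertex hgt_qd -!mulr_sumr.
have -> : \sum_b (r b).+1%:R = n.+1%:R * (n.+1%:R + 1) / 2 :> R.
  rewrite -sum_succ mulrC mulKf ?pnatr_eq0 //.
  by rewrite [RHS](reindex_inj (@perm_inj _ r)).
have -> : \sum_(a in S) (r a).+1%:R = \sum_(a in S) (r a)%:R + #|S|%:R :> R.
  by rewrite -sumr_const -big_split; apply: eq_bigr => a _; rewrite -natr1.
have -> : #|S|%:R * #|S|.-1%:R = #|S|%:R * (#|S|%:R - 1) :> R.
  by case: #|S| => [|k] /=; rewrite ?mul0r // -natr1 addrK.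
rewrite /hbound invfM; have q0 : 0 < n.+1%:R^-1 :> R by rewrite invr_gt0.
have := mulVf N0; have : (2:R)^-1 * 2 = 1 by rewrite mulVf // pnatr_eq0.
have t0 : 0 < 2^-1 :> R by rewrite invr_gt0.
move: (n.+1%:R : R) (n.+1%:R^-1 : R) q0 (2^-1 : R) t0 => N q q0 t t0 t2 qN.
move: (\sum_(a in S) _) (#|S|%:R : R) => sg s h.
have : 0 <= q * (t * (2 * sg - s * (s - 1))) by rewrite !mulr_ge0 ?subr_ge0 // ltW.
have -> : q * (t * (2 * sg - s * (s - 1))) =
  q * (t * 2) * sg - (q * t) * s * (s - 1) by lra.
rewrite t2.
have -> : s * (q * (N * (N + 1) * t)) * q = s * (q * N) * (N + 1) * t * q by lra.
have -> : q * (sg + s) = q * sg + s * q * (t * 2) by rewrite t2; lra.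
rewrite qN; lra.
Qed.

(** * The polyhedron is spanned by its vertices *)

Definition tightset y := [set S | hgt S y == hbound R S]%SET.

Lemma hgt_diff a b S :
  hgt S (qd (fun c => (c == a)%:R - (c == b)%:R)) =
  (a \in S)%:R - (b \in S)%:R :> R.
Proof.
have sum1 (k : 'I_n.+1) (P : pred 'I_n.+1) :
    \sum_(c | P c) (c == k)%:R = (P k)%:R :> R.
  rewrite big_mkcond (bigD1 k) //= eqxx big1 ?addr0; first by case: (P k).
  by move=> i /negbTE ->; case: (P i).
by rewrite hgt_qd !sumrB !sum1 subrr mulr0 mul0r subr0.
Qed.

(* If no tight set separates [a] from [b], moving along [lam a - lam b] keeps
   the tight sets tight until a new one appears. *)
Lemma tight_shift a b y : polyh y -> a != b ->
  (forall S, S \in tightset y -> (a \in S) = (b \in S)) ->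
  exists2 t : R, 0 < t &
    let y' := y + t *: qd (fun c => (c == a)%:R - (c == b)%:R) in
    polyh y' /\ tightset y \proper tightset y'.
Proof.
move=> Py ab sep; set d := qd _.
have hd S : hgt S d = (a \in S)%:R - (b \in S)%:R by exact: hgt_diff.
pose P S := (a \in S) && (b \notin S).
have Pa : P [set a]%SET by rewrite /P !inE eqxx eq_sym.
(* Only heights of sets containing [a] but not [b] grow along [d], at unit rate; the least slack
   among them is the length of the step. *)
case: (@arg_minP _ _ _ [set a]%SET P (fun S => hbound R S - hgt S y) Pa) => S0 PS0 min0.
have slack S : P S -> 0 < hbound R S - hgt S y.
  move=> /andP[aS bS]; rewrite subr_gt0 lt_neqAle Py andbT.
  by apply/negP => tS; have := sep S; rewrite inE tS aS (negbTE bS) => /(_ isT).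
exists (hbound R S0 - hgt S0 y); first exact: slack.
move=> y'; have hy' S : hgt S y' =
    hgt S y + (hbound R S0 - hgt S0 y) * ((a \in S)%:R - (b \in S)%:R).
  by rewrite /y' addrC linearP /= hd addrC.
have t0 := slack _ PS0; split.
  move=> S; rewrite hy'; have := Py S; have := min0 S; rewrite /P.
  by case: (a \in S); case: (b \in S) => /= H; try lra; have := H isT; lra.
apply/properP; split.
  apply/fintype.subsetP => S tS; have := tS; rewrite !inE hy' (sep S tS).
  by rewrite subrr mulr0 addr0.
have /andP[aS bS] := PS0; exists S0; rewrite inE.
  by rewrite hy' aS (negbTE bS) subr0 mulr1 addrC subrK.
by apply/negP => /eqP tS; move: t0; rewrite tS subrr ltxx.
Qed.

(* The smallest tight set [up a] containing [a] stays tight when [a] is removed,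
   so the coordinate at [a] depends on [#|up a|] only. *)
Lemma vertex_of_separated y : polyh y ->
  (forall a b, a != b -> exists2 S, S \in tightset y & (a \in S) != (b \in S)) ->
  exists r, y = vertex r.
Proof.
move=> Py sep.
have tT : [set: 'I_n.+1]%SET \in tightset y by rewrite inE hgtT hboundT.
have t0 : finset.set0 \in tightset y by rewrite inE hgt0 hbound0.
have tI S T : S \in tightset y -> T \in tightset y -> S :&: T \in tightset y.
  by rewrite !inE => /eqP tS /eqP tT'; have [_ -> _] := tight_modular Py tS tT'.
have tU S T : S \in tightset y -> T \in tightset y -> S :|: T \in tightset y.
  by rewrite !inE => /eqP tS /eqP tT'; have [-> _ _] := tight_modular Py tS tT'.
pose up a := (\bigcap_(S in tightset y | a \in S) S)%SET.
(* The part of [up a] covered by tight sets avoiding [a]; by separation it misses only [a], and as a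
   union of tight sets it is tight. *)
pose low a := (\bigcup_(S in tightset y | a \notin S) (S :&: up a))%SET.
have tup a : up a \in tightset y.
  by apply: (big_ind (fun S => S \in tightset y)) => // S /andP[].
have tlow a : low a \in tightset y.
  by apply: (big_ind (fun S => S \in tightset y)) => // S /andP[tS _]; exact: tI.
have aup a : a \in up a by apply/finset.bigcapP => S /andP[].
have upS a S : S \in tightset y -> a \in S -> up a \subset S.
  by move=> tS aS; apply: finset.bigcap_inf; rewrite tS.
have lowE a : low a = up a :\ a.
  apply/setP => b; rewrite !inE; apply/bigcupP/andP.
    by case=> S /andP[tS aS]; rewrite inE => /andP[bS ->]; split=> //;
      apply: contraNneq aS => <-.
  case=> ba bup; have [S tS abS] := sep _ _ ba.
  have aS : a \notin S.
    apply/negP => aS; move: abS; rewrite aS.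
    by rewrite (fintype.subsetP (upS _ _ tS aS) _ bup).
  exists S; first by rewrite tS.
  by rewrite inE bup andbT; move: abS; rewrite (negbTE aS); case: (b \in S).
have up_inj a b : #|up a| = #|up b| -> a = b.
  move=> cab; apply/eqP; apply/negPn/negP => ab.
  have upE : up a = up b.
    have ta := tup a; have tb := tup b; rewrite !inE in ta tb.
    have /orP[s|s] := tight_chain Py (eqP ta) (eqP tb); apply/eqP.
      by rewrite finset.eqEcard s cab leqnn.
    by rewrite eq_sym finset.eqEcard s cab leqnn.
  have [S tS] := sep _ _ ab; have [aS|aS] := boolP (a \in S).
    by rewrite (fintype.subsetP (upS _ _ tS aS)) // upE.
  have [bS|//] := boolP (b \in S).
  by move: aS; rewrite (fintype.subsetP (upS _ _ tS bS)) // -upE.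
(* Larger coordinates belong to smaller sets [up a], so the zero-based rank decreases with the size,
   which ranges over 1, ..., n + 1. *)
pose r a : 'I_n.+1 := inord (n.+1 - #|up a|).
have cup a : (0 < #|up a| <= n.+1)%N.
  rewrite card_gt0 -[X in (_ <= X)%N]card_ord max_card andbT.
  by apply/finset.set0Pn; exists a.
have rv a : r a = (n.+1 - #|up a|)%N :> nat.
  by rewrite /r inordK //; have := cup a; lia.
have rE a : (r a).+1%:R = n.+1%:R + 1 - #|up a|%:R :> R.
  have /andP[u0 uN] := cup a; rewrite rv.
  by rewrite -addn1 natrD natrB //; lra.
have r_inj : injective r.
  move=> a b /(congr1 val); have := cup a; have := cup b.
  rewrite /= !rv => h1 h2 h3; apply: up_inj.
  by move: h1 h2 h3; move: #|up a| #|up b| => p q; lia.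
exists (perm r_inj); rewrite -[LHS]qd_ccoord /vertex.
(* The constant is the mean of 1, ..., n + 1 divided by n + 1; subtracting it centers the
   coordinates of the vertex. *)
rewrite -[RHS]subr0 -[X in _ - X](@qd_const _ _ ((n.+1%:R + 1) / (2 * n.+1%:R))) -qdB.
apply: eq_qd => a; rewrite permE rE.
have -> : ccoord y a = hgt (up a) y - hgt (low a) y.
  rewrite lowE /hgt (bigD1 a) //= (_ : \sum_(i in _ :\ _) _ =
    \sum_(i in up a | i != a) ccoord y i) ?addrK //.
  by apply: eq_bigl => i; rewrite !inE andbC.
have := tup a; have := tlow a; rewrite !inE => /eqP -> /eqP ->.
rewrite lowE /hbound; have := cardsD1 a (up a); rewrite aup => ->.
rewrite natrD (_ : true%:R = 1 :> R) // invfM.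
have := mulVf N0; have : (2:R)^-1 * 2 = 1 by rewrite mulVf // pnatr_eq0.
move: (n.+1%:R : R) (n.+1%:R^-1 : R) (2^-1 : R) (#|up a :\ a|%:R : R).
move=> N q t k t2 qN.
have -> : q * (N + 1 - (1 + k)) = (t * 2) * q * (N + 1 - (1 + k)) by rewrite t2; lra.
lra.
Qed.

(** Induction on the number of sets that are not tight: if two indices are not separated by tight
    sets, [y] lies between two points, reached in opposite directions, that have more tight sets. *)
Lemma polyh_in_convex (K : set 'rV[R]_n) :
  (forall x y (t : R), K x -> K y -> 0 <= t <= 1 -> K (t *: x + (1 - t) *: y)) ->
  (forall r, K (vertex r)) -> polyh `<=` K.
Proof.
move=> cK vK y.
have [k] := ubnP (#|{set 'I_n.+1}| - #|tightset y|); elim: k y => // k IH y.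
rewrite ltnS => ky Py.
have [sep|] := pselect (forall a b, a != b ->
    exists2 S, S \in tightset y & (a \in S) != (b \in S)).
  by have [r ->] := vertex_of_separated Py sep.
move=> /existsNP[a /existsNP[b /not_implyP[ab nsep]]].
have {}nsep S : S \in tightset y -> (a \in S) = (b \in S).
  by move=> tS; apply/eqP/negPn/negP => abS; apply: nsep; exists S.
have IH' y' : polyh y' -> tightset y \proper tightset y' -> K y'.
  move=> Py' /proper_card ty; apply: IH => //; apply: leq_trans ky.
  by apply: ltn_sub2l => //; apply: leq_trans ty (max_card _).
have [t t0 [P1 T1]] := tight_shift Py ab nsep.
have ba : b != a by rewrite eq_sym.
have [u u0 [P2 T2]] := tight_shift Py ba (fun S tS => esym (nsep S tS)).
(* With these weights the opposite displacements by [t] and [u] cancel. *)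
have := cK _ _ (u / (t + u)) (IH' _ P1 T1) (IH' _ P2 T2).
have tu : t + u != 0 by rewrite gt_eqF ?addr_gt0.
have -> : qd (fun c => (c == b)%:R - (c == a)%:R) =
    - qd (fun c => (c == a)%:R - (c == b)%:R) :> 'rV[R]_n.
  by rewrite -qdN; apply: eq_qd => c; rewrite opprB.
rewrite (_ : 1 - u / (t + u) = t / (t + u)); last first.
  by rewrite -[1](divff tu) -mulrBl addrK.
rewrite !scalerDr !scalerN !scalerA addrACA -scalerDl -mulrDl (addrC u) divff //.
rewrite scale1r (_ : t / _ * u = u / (t + u) * t) ?subrr ?addr0; last by lra.
apply; rewrite divr_ge0 ?addr_ge0 ?(ltW t0) ?(ltW u0) //=.
by rewrite ler_pdivrMr ?addr_gt0 // mul1r; lra.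
Qed.

Lemma permutohedronE : permutohedron R n = polyh.
Proof.
apply/seteqP; split.
  apply: smallest_sub => [x y t|_ [s _ <-]]; last by rewrite vertexE; exact: polyh_vertex.
  rewrite !inE => Px Py S; rewrite linearD !linearZ /=.
  have t0 : 0 <= t%:num by [].
  have t1 : t%:num <= 1 by [].
  by have := Px S; have := Py S; rewrite /unstable.onem; nra.
move=> y Py K [cK vK]; apply: polyh_in_convex Py => [x z t Kx Kz /andP[t0 t1]|r].
  exact: convex_set_combination.
by apply: vK; exists r^-1%g => //; rewrite vertexE invgK.
Qed.
End PermutohedronInequalities.

(** * Faces of a cell *)

Lemma near_sub (T : topologicalType) (x : T) (P Q : T -> Prop) :
  (forall y, P y -> Q y) -> (\forall y \near x, P y) -> \forall y \near x, Q y.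
Proof. exact: filterS. Qed.

Lemma near_forall (T : topologicalType) (I : finType) (x : T) (P : I -> T -> Prop) :
  (forall i, \forall y \near x, P i y) -> \forall y \near x, forall i, P i y.
Proof. exact: filter_forall. Qed.

Lemma near_lt (R : realType) (T : topologicalType) (f : T -> R) (x : T) (b : R)
  (P : T -> Prop) :
  f x < b -> continuous f -> (forall y, f y < b -> P y) -> \forall y \near x, P y.
Proof. by move=> fx cf fP; apply: filterS fP (cvgr_lt _ (cf x) _ fx). Qed.

Lemma near_imply (T : topologicalType) (x : T) (Q : Prop) (P : T -> Prop) :
  (Q -> \forall y \near x, P y) -> \forall y \near x, Q -> P y.
Proof.
move=> QP; have [/QP|nQ] := pselect Q; last by apply: nearW => y /nQ.
by apply: filterS.
Qed.

(** Such a map is a finite sum of coordinate functions times fixed vectors. *)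
Lemma linear_rV_continuous (R : realType) n (W : normedModType R)
  (f : 'rV[R]_n -> W) : linear f -> continuous f.
Proof.
move=> lf; pose g : {linear 'rV[R]_n -> W} :=
  HB.pack f (GRing.isLinear.Build R 'rV[R]_n W *:%R f lf).
have fE : f =1 (fun x => \sum_(j < n) x 0 j *: g (delta_mx 0 j)).
  move=> x; rewrite -[f x]/(g x) {1}[x]row_sum_delta linear_sum.
  by apply: eq_bigr => j _; rewrite linearZ.
rewrite (funext fE); apply: continuous_big => [|j _ x]; first exact: add_continuous.
have c := @coord_continuous R 1 n 0 j x.
exact: (cvgZr_tmp (a := g (delta_mx 0 j)) c).
Qed.

Lemma hgt_continuous (R : realType) n (S : {set 'I_n.+1}) :
  continuous (@hgt R n S).
Proof. exact: (@linear_rV_continuous R n R (hgt S) (hgt_is_linear S)). Qed.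

Lemma nbhs_line (R : realType) n (x d : 'rV[R]_n) (A : set 'rV[R]_n) :
  nbhs x A -> exists2 e : R, 0 < e & A (x + e *: d).
Proof.
move=> Ax; have fx : x + e *: d @[e --> (0 : R)] --> x.
  have -> : nbhs x = nbhs (x + 0 *: d) by rewrite scale0r addr0.
  by apply: cvgD; [exact: cvg_cst|apply: cvgZr_tmp; exact: cvg_id].
have /nbhs_ballP[r /= r0 rA] := fx _ Ax.
exists (r / 2); first by rewrite divr_gt0.
by apply: rA; rewrite /ball /= sub0r normrN gtr0_norm ?divr_gt0 //; lra.
Qed.

Section Cells.
Variables (R : realType) (n : nat).
Implicit Types (x y l : 'rV[R]_n) (S : {set 'I_n.+1}).
Implicit Types (T : {set {set 'I_n.+1}}) (F : set 'rV[R]_n).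

Definition cell l : set 'rV[R]_n := [set x | polyh (x - l)].

(* The improper sets are excluded because they are always tight. *)
Definition ptight l x :=
  [set S | proper_set S && (hgt S (x - l) == hbound R S)]%SET.

Lemma translate_permutohedron l : translate l (permutohedron R n) = cell l.
Proof.
rewrite permutohedronE; apply/seteqP; split=> [_ [y Py <-]|x Px].
  by rewrite /cell /= addrC addKr.
by exists (x - l) => //; rewrite addrC subrK.
Qed.

Lemma hbound_gt0 S : proper_set S -> 0 < hbound R S.
Proof.
move=> /card_proper /andP[S0 SN]; rewrite /hbound.
by rewrite divr_gt0 ?mulr_gt0 ?subr_gt0 ?ltr0n ?ltr_nat.
Qed.

Lemma hgt_improper S x : ~~ proper_set S -> hgt S x = hbound R S.
Proof.
by rewrite negb_and !negbK => /orP[]/eqP->;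
  rewrite ?hgt0 ?hbound0 ?hgtT ?hboundT.
Qed.

Lemma ptightP l x S :
  reflect (proper_set S /\ hgt S (x - l) = hbound R S) (S \in ptight l x).
Proof. by rewrite inE; apply: (iffP andP) => -[? /eqP]. Qed.

(** Inequalities strict at [x] stay strict nearby, so only those tight at [x] can fail or become
    equalities. *)
Lemma cell_near l x : cell l x ->
  \forall y \near x,
    ((forall S, S \in ptight l x -> hgt S (y - x) <= 0) -> cell l y) /\
    ptight l y \subset ptight l x.
Proof.
move=> Px.
have near1 S : \forall y \near x,
    hgt S (x - l) < hbound R S -> hgt S (y - l) < hbound R S.
  apply: near_imply => lt_S.
  have lt_S' : hgt S x < hbound R S + hgt S l by rewrite -ltrBlDr -linearB.
  apply: (@near_lt R 'rV[R]_n (hgt S) x _ _ lt_S'); first exact: hgt_continuous.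
  by move=> y; rewrite linearB /= ltrBlDr.
apply: near_sub (near_forall near1) => y hy; split=> [tS S|]; last first.
  apply/fintype.subsetP => S /ptightP[pS tS]; apply/ptightP; split=> //.
  apply/eqP; rewrite eq_le Px leNgt; apply/negP => /hy.
  by rewrite tS ltxx.
have [pS|/hgt_improper -> //] := boolP (proper_set S).
have := Px S; rewrite le_eqVlt => /orP[/eqP tSx|/hy/ltW //].
have -> : y - l = (y - x) + (x - l) by rewrite addrA subrK.
by rewrite linearD /= tSx gerDr; apply: tS; apply/ptightP.
Qed.

Definition face_of l T : set 'rV[R]_n :=
  [set y | cell l y /\ T \subset ptight l y].

Lemma hgt_tight_sub l x y S :
  S \in ptight l x -> S \in ptight l y -> hgt S (y - x) = 0.
Proof.
move=> /ptightP[_ tx] /ptightP[_ ty].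
have -> : y - x = (y - l) - (x - l) by rewrite opprB addrA subrK.
by rewrite linearB /= tx ty subrr.
Qed.

Lemma ptight_shift l x d S :
  hgt S d = 0 -> (S \in ptight l (x + d)) = (S \in ptight l x).
Proof. by move=> d0; rewrite !inE addrAC linearD /= d0 addr0. Qed.

Lemma face_of_near l x : cell l x ->
  \forall y \near x, (forall S, S \in ptight l x -> hgt S (y - x) = 0) ->
    face_of l (ptight l x) y.
Proof.
move=> Px; apply: near_sub (cell_near Px) => y [hy _] y0; split.
  by apply: hy => S /y0 ->.
apply/fintype.subsetP => S Sx.
by rewrite -[y](subrK x) addrC ptight_shift ?y0.
Qed.

Lemma face_of_self l x : cell l x -> face_of l (ptight l x) x.
Proof. by []. Qed.

(** A solution [y] of the tight equations lies on the line through [x] and a nearby point, which is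
    in the face because the other inequalities still hold there. *)
Lemma aff_hull_face l x : cell l x ->
  aff_hull (face_of l (ptight l x)) =
  [set y | forall S, S \in ptight l x -> hgt S (y - x) = 0].
Proof.
move=> Px; apply/seteqP; split.
  apply: smallest_sub => [y z t hy hz S Sx|y [_ /fintype.subsetP yT] S Sx].
    have -> : (1 - t) *: y + t *: z - x = (1 - t) *: (y - x) + t *: (z - x).
      rewrite !scalerBr addrACA -opprD -scalerDl subrK scale1r //.
    by rewrite linearD !linearZ /= hy // hz // !mulr0 addr0.
  exact: hgt_tight_sub Sx (yT _ Sx).
move=> y hy A [affA subA].
have [e e0 He] := nbhs_line (y - x) (face_of_near Px).
have Ax : A x by apply: subA; exact: face_of_self.
have Axe : A (x + e *: (y - x)).
  by apply: subA; apply: He => S Sx; rewrite addrC addKr linearZ /= hy ?mulr0.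
have := affA _ _ e^-1 Ax Axe.
rewrite scalerDr scalerA mulVf ?gt_eqF // scale1r addrA -scalerDl subrK scale1r.
by rewrite addrC subrK.
Qed.

(** If a set were tight at [y] but not at [x], a short step from [y] away from [x] would stay in the
    affine hull and violate its inequality. *)
Lemma relint_face l x : cell l x ->
  relint (face_of l (ptight l x)) =
  [set y | cell l y /\ ptight l y = ptight l x].
Proof.
move=> Px; rewrite /relint aff_hull_face //; apply/seteqP; split=> y /=.
  move=> [[Py /[dup] sxy /fintype.subsetP xy] ny]; split=> //.
  apply/eqP; rewrite finset.eqEsubset sxy andbT; apply/fintype.subsetP => S Sy.
  have [e e0 He] := nbhs_line (y - x) ny.
  have [|Pe _] := He.
    move=> U Ux; rewrite addrAC linearD linearZ /=.
    by rewrite (hgt_tight_sub Ux (xy _ Ux)) mulr0 addr0.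
  have /ptightP[pS tS] := Sy; apply/ptightP; split=> //.
  apply/eqP; rewrite eq_le Px /=; have := Pe S.
  rewrite addrAC linearD linearZ /= tS gerDl pmulr_rle0 //.
  have -> : y - x = (y - l) - (x - l) by rewrite opprB addrA subrK.
  by rewrite linearB /= tS subr_le0.
move=> [Py Tyx]; split; first by split; rewrite ?Tyx.
apply: near_sub (face_of_near Py) => z; rewrite Tyx => hz zx; apply: hz => S Sx.
have -> : z - y = (z - x) - (y - x) by rewrite opprB addrA subrK.
by rewrite linearB /= zx // (hgt_tight_sub Sx) ?subr0 // Tyx.
Qed.

(** For [y] in [F] the segment from [y] to [x] can be prolonged inside [F], so sets tight at [x] are
    tight at [y]. If conversely they are tight at [y], it can be prolonged inside the cell, so the
    inequality cutting out [F] is an equality at [y]. *)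
Lemma is_face_relint l F x :
  is_face (cell l) F -> relint F x -> F = face_of l (ptight l x).
Proof.
move=> [L [b [Lb FE]]] [Fx nx].
have [Px Lx] : cell l x /\ L x = b by move: Fx; rewrite FE.
apply/seteqP; split=> y.
  move=> Fy; split; first by move: Fy; rewrite FE => -[].
  have [e e0 He] := nbhs_line (x - y) nx.
  have : F (x + e *: (x - y)).
    apply: He => A [affA subA]; have := affA _ _ (1 + e) (subA _ Fy) (subA _ Fx).
    rewrite opprD addrA subrr sub0r scaleNr scalerDl scale1r scalerBr.
    by rewrite addrC addrA.
  rewrite FE => -[Pe _]; have Py : cell l y by move: Fy; rewrite FE => -[].
  apply/fintype.subsetP => S /ptightP[pS tS]; apply/ptightP; split=> //.
  apply/eqP; rewrite eq_le Py /=; have := Pe S.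
  rewrite addrAC linearD linearZ /= tS gerDl pmulr_rle0 //.
  have -> : x - y = (x - l) - (y - l) by rewrite opprB addrA subrK.
  by rewrite linearB /= tS subr_le0.
move=> [Py /fintype.subsetP xy]; rewrite FE; split=> //.
have [e e0 He] := nbhs_line (x - y) (face_of_near Px).
have [|/Lb + _] := He.
  by move=> S Sx; rewrite addrC addKr linearZ /= -opprB linearN /=
    (hgt_tight_sub Sx (xy _ Sx)) oppr0 mulr0.
rewrite linearD linearZ linearB /= Lx gerDl pmulr_rle0 // subr_le0 => bLy.
by apply/eqP; rewrite eq_le bLy Lb.
Qed.

Definition hgt_sum T x : R := \sum_(S in T) hgt S x.

Lemma hgt_sum_is_linear T : linear_for *%R (hgt_sum T).
Proof.
move=> k x y; rewrite /hgt_sum mulr_sumr -big_split /=.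
by apply: eq_bigr => S _; rewrite linearP.
Qed.

HB.instance Definition _ T :=
  GRing.isLinear.Build R 'rV[R]_n R *%R (hgt_sum T) (hgt_sum_is_linear T).

(** The sum of the inequalities in [T] cuts out the face: nonnegative slacks sum to 0 only if each
    is 0. *)
Lemma is_face_face_of l T :
  (forall S, S \in T -> proper_set S) -> is_face (cell l) (face_of l T).
Proof.
move=> pT; exists (hgt_sum T); exists (\sum_(S in T) hbound R S + hgt_sum T l).
have E y : hgt_sum T y = \sum_(S in T) hgt S (y - l) + hgt_sum T l.
  by rewrite -/(hgt_sum T (y - l)) linearB /= subrK.
split=> [y Py|].
  rewrite /= E; apply: lerD => //.
  by  apply: ler_sum => S _; exact: Py.
apply/seteqP; split=> y [Py].
  move=> /fintype.subsetP Ty; split=> //; rewrite /= E; congr (_ + _).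
  by apply: eq_bigr => S /Ty /ptightP[].
rewrite /= E => /addIr /esym/eqP; rewrite -subr_eq0 -sumrB psumr_eq0; last first.
  by move=> S _; rewrite subr_ge0; exact: Py.
move=> /allP T0; split=> //; apply/fintype.subsetP => S ST.
apply/ptightP; split; first exact: pT.
have := T0 S; rewrite mem_index_enum ST /= subr_eq0 => /(_ isT) /eqP.
by [].
Qed.

Lemma cell_center l : cell l l.
Proof.
move=> S; rewrite subrr linear0; have [/hbound_gt0/ltW //|pS] := boolP (proper_set S).
by rewrite -(hgt_improper 0 pS) linear0.
Qed.

Lemma ptight_center l S : S \notin ptight l l.
Proof.
apply/negP => /ptightP[/hbound_gt0 + h]; rewrite -h subrr linear0.
by rewrite ltxx.
Qed.

Lemma boundary_permutohedron :
  boundary (permutohedron R n) =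
  [set y | cell 0 y /\ ptight 0 y != finset.set0].
Proof.
have PE : permutohedron R n = cell 0.
  by rewrite permutohedronE; apply/seteqP; split=> y; rewrite /cell /= subr0.
have Pcl : closed (cell 0).
  have -> : cell 0 = \bigcap_(S in setT) (hgt S @^-1` [set t | t <= hbound R S]).
    apply/seteqP; split=> y; rewrite /cell /polyh /= ?subr0 => Py S.
      by move=> _; exact: Py.
    exact: Py.
  apply: closed_bigI => S _; apply: closed_comp => [y _|]; last exact: closed_le.
  exact: hgt_continuous.
rewrite /boundary PE -(closure_id _).1 //; apply/seteqP; split=> y [Py].
  move=> nint; split=> //; apply/negP => /eqP T0; apply: nint.
  apply: near_sub (cell_near Py) => z [+ _]; apply => S.
  by rewrite T0 inE.
move=> /finset.set0Pn[S /ptightP[pS tS]]; split=> // ny.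
(* A step along [vecS R S] raises the height of [S] and leaves the cell. *)
have [e e0 /(_ S)] := nbhs_line (vecS R S) ny.
rewrite addrAC linearD linearZ /= tS gerDl hgt_vecS_hbound pmulr_rle0 //.
by rewrite leNgt mulr_gt0 ?hbound_gt0.
Qed.
End Cells.

(** * The honeycomb and its strata in terms of cells *)

Section Honeycomb.
Variables (R : realType) (n : nat).
Implicit Types (x y l p : 'rV[R]_n) (S : {set 'I_n.+1}) (F : set 'rV[R]_n).

Lemma LambdaP l :
  Lambda R n l <-> exists z : 'I_n.+1 -> int, l = qd (fun a => (z a)%:~R).
Proof.
by split=> [[z _ <-]|[z ->]]; exists z => //; rewrite sum_lam.
Qed.

Lemma Lambda_addvec l S : Lambda R n l -> Lambda R n (l + vecS R S).
Proof.
move=> /LambdaP[z ->]; apply/LambdaP; exists (fun a => z a + (a \in S)%:R).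
by rewrite /vecS -qdD; apply: eq_qd => a; rewrite intrD; case: (a \in S).
Qed.

Definition cells x : set 'rV[R]_n := [set l | Lambda R n l /\ cell l x].

(** By [polyh_neighbor] any other cell through [x] differs by the vector of a tight set; by
    [polyh_sub_vecS] every tight set gives such a cell. *)
Lemma cells_ptight l x : cells x l ->
  cells x = [set l' | l' = l \/ exists2 S, S \in ptight l x & l' = l + vecS R S].
Proof.
move=> [Ll Px]; apply/seteqP; split=> l'.
  move=> [/LambdaP[z' El'] Px']; have /LambdaP[z El] := Ll.
  have [->|/eqP ll'] := eqVneq l' l; [by left|right].
  pose dz a := z' a - z a.
  have dE : l' - l = qd (fun a => (dz a)%:~R).
    by rewrite El El' -qdB; apply: eq_qd => a; rewrite intrB.
  have [||S [pS E tS]] := @polyh_neighbor _ _ dz (x - l) Px.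
  - by rewrite -dE opprB addrA subrK.
  - by rewrite -dE => /eqP; rewrite subr_eq0 => /eqP.
  by exists S; [apply/ptightP|rewrite -E -dE addrC subrK].
case=> [->//|[S /ptightP[pS tS] ->]]; split; first exact: Lambda_addvec.
by rewrite /cell /= opprD addrA; exact: polyh_sub_vecS.
Qed.

Lemma vecS_neq0 S : proper_set S -> vecS R S != 0.
Proof.
move=> pS; apply/eqP => v0; have := hgt_vecS_hbound R S.
by rewrite v0 linear0 => /esym/eqP; rewrite mulf_eq0 pnatr_eq0 /= gt_eqF ?hbound_gt0.
Qed.

Lemma ptight_cells l x S : cells x l ->
  S \in ptight l x <-> proper_set S /\ cells x (l + vecS R S).
Proof.
move=> cl; split=> [tS|[pS [_ Px']]].
  by split; [have /ptightP[] := tS|rewrite (cells_ptight cl); right; exists S].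
have [_ Px] := cl; apply/ptightP; split=> //.
(* In the neighboring cell, the inequality of the complement is the reverse of that of [S] in the
   cell of [l]. *)
apply/eqP; rewrite eq_le Px /=; have := Px' (~: S).
rewrite opprD addrA linearB /= !hgtC hboundC hgt_vecS_hbound opprK.
by lra.
Qed.

Lemma eq_cells l x y : cells x l ->
  cells y = cells x <-> cell l y /\ ptight l y = ptight l x.
Proof.
move=> cl; split=> [cyx|[Py tyx]].
  have cly : cells y l by rewrite cyx.
  split; first by case: cly.
  apply/setP => S; apply/idP/idP.
    by move=> /(ptight_cells _ cly); rewrite cyx => /(ptight_cells _ cl).
  by move=> /(ptight_cells _ cl); rewrite -cyx => /(ptight_cells _ cly).
have cly : cells y l by case: cl.
by rewrite (cells_ptight cl) (cells_ptight cly) tyx.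
Qed.

Lemma honeycomb_ptight x :
  honeycomb R n x <-> exists2 l, cells x l & ptight l x != finset.set0.
Proof.
split=> [[l Ll [y + <-]]|[l [Ll Px] t0]].
  rewrite boundary_permutohedron => -[Py t0]; exists l.
    by split=> //; rewrite /cell /= addrC addKr; rewrite /cell /= subr0 in Py.
  apply: contra_neq t0 => <-; apply/setP => S.
  by rewrite !inE subr0 addrC addKr.
exists l => //; exists (x - l); last by rewrite addrC subrK.
rewrite boundary_permutohedron; split; first by rewrite /cell /= subr0.
apply: contra_neq t0 => <-; apply/setP => S.
by rewrite !inE subr0.
Qed.

Lemma honeycombE x :
  honeycomb R n x <-> exists l l', [/\ cells x l, cells x l' & l <> l'].
Proof.
split=> [/honeycomb_ptight[l cl /finset.set0Pn[S tS]]|[l [l' [cl cl' ll']]]].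
  have [pS cS] := (ptight_cells S cl).1 tS.
  exists l, (l + vecS R S); split=> // /eqP.
  by rewrite eq_sym -subr_eq0 addrC addKr (negbTE (vecS_neq0 pS)).
apply/honeycomb_ptight; exists l => //; move: cl'; rewrite (cells_ptight cl).
by case=> [/esym//|[S tS _]]; apply/finset.set0Pn; exists S.
Qed.

Lemma honeycomb_face_relint F x : honeycomb_face F -> relint F x ->
  exists l, [/\ cells x l, ptight l x != finset.set0 & F = face_of l (ptight l x)].
Proof.
move=> [l Ll]; rewrite translate_permutohedron => -[fF _ FnP] Fx.
have FE := is_face_relint fF Fx.
have Px : cell l x by have [] := Fx; rewrite FE => -[].
exists l; split=> //; apply/eqP => T0; apply: FnP; rewrite FE T0.
by apply/seteqP; split=> [y []//|y Py]; split=> //; exact: finset.sub0set.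
Qed.

(** Tight sets depend on a chosen cell, but they carry the same information as [cells x], which does
    not; this makes the strata comparable across cells. *)
Lemma relint_honeycomb_face F x : honeycomb_face F -> relint F x ->
  honeycomb R n x /\ relint F = [set y | cells y = cells x].
Proof.
move=> hF Fx; have [l [cl t0 FE]] := honeycomb_face_relint hF Fx.
split; first by apply/honeycomb_ptight; exists l.
rewrite FE relint_face; last by case: cl.
by apply/seteqP; split=> y; rewrite /= (eq_cells _ cl).
Qed.

Lemma honeycomb_face_exists x : honeycomb R n x ->
  exists2 F, honeycomb_face F & relint F x.
Proof.
move=> /honeycomb_ptight[l [Ll Px] t0].
exists (face_of l (ptight l x)); last by rewrite relint_face.
exists l => //; rewrite translate_permutohedron; split.
- by apply: is_face_face_of => S /ptightP[].
- by exists x; exact: face_of_self.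
(* Nothing is tight at the center [l], so the face is not the whole cell. *)
move=> E; have : face_of l (ptight l x) l by rewrite E; exact: cell_center.
move=> [_ /fintype.subsetP s]; have /finset.set0Pn[S /s] := t0.
by rewrite (negbTE (ptight_center _ _)).
Qed.

(** Crossing a tight set [S'] from the cell of [S] leads to the cell of some [S''] in [TT], and the
    height of [S''] is the sum of those of [S] and [S']. So the inequality of [S'] compares [S'']
    with [S]. The empty set stands for [l0]. *)
Lemma local_cells l0 p : cells p l0 ->
  let TT := (finset.set0 |: ptight l0 p)%SET in
  \forall x \near p, forall l, cells x l <->
    exists S, [/\ S \in TT, l = l0 + vecS R S &
      forall S', S' \in TT -> hgt S' (x - p) <= hgt S (x - p)].
Proof.
move=> cl0 TT.
have cTT S : S \in TT -> cells p (l0 + vecS R S).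
  rewrite finset.in_setU finset.in_set1 => /orP[/eqP->|tS].
    by rewrite vecS0 addr0.
  by have [] := (ptight_cells S cl0).1 tS.
have TTc l : cells p l -> exists2 S, S \in TT & l = l0 + vecS R S.
  rewrite (cells_ptight cl0) => -[->|[S tS ->]].
    by exists finset.set0; rewrite ?vecS0 ?addr0 // setU11.
  by exists S => //; rewrite finset.in_setU tS orbT.
have diff S S' : S \in TT -> S' \in ptight (l0 + vecS R S) p ->
    exists S'', [/\ S'' \in TT, l0 + vecS R S + vecS R S' = l0 + vecS R S'' &
      forall d : 'rV[R]_n, hgt S'' d = hgt S d + hgt S' d].
  move=> ST tS'; have [_ /TTc[S'' S''T E]] := (ptight_cells S' (cTT _ ST)).1 tS'.
  exists S''; split=> // d; apply/esym; apply: hgt_vecS_lin.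
  by move: E; rewrite -addrA => /addrI.
have near1 S : \forall x \near p, S \in TT ->
    ((forall S', S' \in ptight (l0 + vecS R S) p -> hgt S' (x - p) <= 0) ->
     cell (l0 + vecS R S) x) /\
    ptight (l0 + vecS R S) x \subset ptight (l0 + vecS R S) p.
  by apply: near_imply => ST; exact: cell_near (cTT _ ST).2.
apply: near_sub (near_forall near1) => x near_x.
have max_cell S : S \in TT ->
    (forall S', S' \in TT -> hgt S' (x - p) <= hgt S (x - p)) ->
    cells x (l0 + vecS R S).
  move=> ST maxS; split; first by have [] := cTT _ ST.
  apply: (near_x _ ST).1 => S' tS'; have [S'' [S''T _ hE]] := diff _ _ ST tS'.
  by have := maxS _ S''T; rewrite hE gerDl.
move=> l; split=> [cl|[S [ST -> maxS]]]; last exact: max_cell.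
(* Every other cell through [x] is reached from that of a maximizer across a set tight at both [p]
   and [x], which has height 0 at [x - p]; hence it comes from a maximizer too. *)
case: (@arg_maxP _ _ _ finset.set0 [in TT] (fun S => hgt S (x - p)) (setU11 _ _)).
move=> S ST maxS; have cS := max_cell _ ST maxS.
move: cl; rewrite (cells_ptight cS) => -[->|[S' tS' ->]].
  by exists S.
have tS'p : S' \in ptight (l0 + vecS R S) p.
  exact: (fintype.subsetP (near_x _ ST).2).
have [S'' [S''T E hE]] := diff _ _ ST tS'p.
exists S''; split=> // U UT; rewrite hE.
by rewrite (hgt_tight_sub tS'p tS') addr0; exact: maxS.
Qed.
End Honeycomb.

(** * Linear independence of chains, and the arboreal singularity *)

Section ChainIndependence.
Variables (R : realType) (n k : nat) (f : 'I_k -> {set 'I_n.+1}).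
Hypothesis f_inj : injective f.
Hypothesis f_proper : forall i, proper_set (f i).
Hypothesis f_chain : forall i j, (f i \subset f j) || (f j \subset f i).

(* Test on [lam a - lam b] with [a] in [f i] and [b] in the next larger set of
   the chain (or outside [f i] if there is none) but not in [f i]. *)
Lemma chain_free (c : 'I_k -> R) :
  (forall x : 'rV[R]_n, \sum_i c i * hgt (f i) x = 0) -> forall i, c i = 0.
Proof.
move=> c0 i; have [N] := ubnP #|f i|; elim: N i => // N IH i.
rewrite ltnS => iN.
pose up U := (U == [set: 'I_n.+1]%SET) || [exists j, (U == f j) && (f i \proper U)].
have upT : up [set: 'I_n.+1]%SET by rewrite /up eqxx.
case: (@arg_minnP _ _ up (fun U => #|U|) upT) => U upU minU.
have iU : f i \proper U.
  move: upU => /orP[/eqP->|/existsP[j /andP[_ //]]].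
  by rewrite finset.properT; have /andP[] := f_proper i.
have /properP[_ [b bU bi]] := iU.
have /andP[/finset.set0Pn[a ai] _] := f_proper i.
have U_sub j : f i \proper f j -> U \subset f j.
  move=> ij; have Uj : (#|U| <= #|f j|)%N.
    by apply: minU; apply/orP; right; apply/existsP; exists j; rewrite eqxx.
  have : (U \subset f j) || (f j \subset U).
    move: upU => /orP[/eqP->|/existsP[l /andP[/eqP-> _]]].
      by rewrite finset.subsetT orbT.
    exact: f_chain.
  case/orP => // jU; have /eqP -> // : f j == U.
  by rewrite finset.eqEcard jU.
have := c0 (qd (fun c => (c == a)%:R - (c == b)%:R)).
rewrite (bigD1 i) //= hgt_diff ai (negbTE bi) subr0 mulr1 big1 ?addr0 //.
move=> j ji; have [lt_ji|le_ij] := ltnP #|f j| #|f i|.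
  by rewrite IH ?mul0r //; exact: leq_trans lt_ji iN.
have sij : f i \subset f j.
  case/orP: (f_chain i j) => // sji; have /eqP -> // : f j == f i.
  by rewrite finset.eqEcard sji.
have pij : f i \proper f j.
  rewrite finset.properEneq sij andbT; apply: contraNneq ji => E.
  by rewrite (f_inj E).
rewrite hgt_diff (fintype.subsetP sij _ ai) (fintype.subsetP (U_sub _ pij) _ bU).
by rewrite subrr mulr0.
Qed.

(** By [chain_free] the matrix [H] of the functionals has full rank, so the joint map is onto and
    rank-nullity applies. *)
Lemma dim_chain_ker (W : {vspace 'rV[R]_n}) :
  (forall x, x \in W <-> forall i, hgt (f i) x = 0) -> (\dim W + k)%N = n.
Proof.
move=> WE.
pose H : 'M[R]_(n, k) := \matrix_(i, j) hgt (f j) (delta_mx 0 i).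
have HE x j : (x *m H) 0 j = hgt (f j) x.
  rewrite [x in RHS]row_sum_delta linear_sum mxE; apply: eq_bigr => i _.
  by rewrite linearZ /= mxE.
have /row_fullP[B BH] : row_full H.
  rewrite /row_full -mxrank_tr; apply: inj_row_free => v vH.
  apply/rowP => j; rewrite [RHS]mxE; apply: (chain_free (c := fun j => v 0 j)).
  move=> x; have E : (x *m (v *m H^T)^T) 0 0 = 0 by rewrite vH trmx0 mulmx0 mxE.
  rewrite -[RHS]E trmx_mul trmxK mulmxA mxE.
  by apply: eq_bigr => i _; rewrite HE mxE mulrC.
pose g := linfun (mulmxr H : 'rV[R]_n -> 'rV[R]_k).
have kerg : lker g = W.
  apply/vspaceP => x; rewrite memv_ker lfunE /=; apply/eqP/idP.
    by move=> xH; apply/WE => i; rewrite -HE xH mxE.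
  by move=> /WE xW; apply/rowP => j; rewrite HE xW mxE.
have imgg : limg g = fullv.
  apply/eqP; rewrite eqEsubv subvf; apply/subvP => y _.
  apply/memv_imgP; exists (y *m B); rewrite ?memvf // lfunE /=.
  by rewrite -mulmxA BH mulmx1.
have := limg_ker_dim g fullv; rewrite imgg capfv kerg !dimvf.
by rewrite /dim /= !mul1n.
Qed.
End ChainIndependence.

(** * The arboreal singularity in terms of sets of minimizers *)

Section ArborealStrata.
Variables (R : realType) (m : nat) (w : 'I_m.+1 -> 'rV[R]_m).
Hypothesis m_gt0 : (0 < m)%N.
Hypothesis w_free : affinely_independent w.
Hypothesis w_bary : barycenter w = 0.
Implicit Types (c d : 'I_m.+1 -> R) (I J : {set 'I_m.+1}) (b : 'rV[R]_m).

Definition comb c : 'rV[R]_m := \sum_j c j *: w j.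

Lemma sum_w : \sum_j w j = 0.
Proof.
by move/eqP: w_bary; rewrite scaler_eq0 invr_eq0 pnatr_eq0 /= => /eqP.
Qed.

Lemma combD c d : comb (fun j => c j + d j) = comb c + comb d.
Proof. by rewrite /comb -big_split; apply: eq_bigr => j _; rewrite scalerDl. Qed.

Lemma combZ (k : R) c : comb (fun j => k * c j) = k *: comb c.
Proof. by rewrite /comb scaler_sumr; apply: eq_bigr => j _; rewrite scalerA. Qed.

Lemma comb_const (k : R) : comb (fun=> k) = 0.
Proof. by rewrite /comb -scaler_sumr sum_w scaler0. Qed.

Lemma comb_inj c d : comb c = comb d -> exists k, forall j, c j = d j + k.
Proof.
move=> E; pose s := (\sum_j (c j - d j)) / m.+1%:R.
(* Subtracting the mean [s] gives coefficients of sum 0, as affine independence requires. *)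
exists s => j; apply/eqP; rewrite -subr_eq0 opprD addrA; apply/eqP.
apply: (w_free (c := fun j => c j - d j - s)).
  rewrite sumrB sumr_const card_ord -mulr_natr mulfVK ?subrr // pnatr_eq0.
have -> : \sum_i (c i - d i - s) *: w i = comb c + (-1) *: comb d + comb (fun=> - s).
  by rewrite -combZ -!combD; apply: eq_bigr => i _; congr (_ *: _); lra.
by rewrite comb_const E scaleN1r subrr addr0.
Qed.

Definition mins c := [set j | [forall i, c j <= c i]]%SET.

Lemma minsP c j : reflect (forall i, c j <= c i) (j \in mins c).
Proof. by rewrite inE; exact: forallP. Qed.

Lemma mins_shift c d (k : R) : (forall j, c j = d j + k) -> mins c = mins d.
Proof.
by move=> E; apply/setP => j; apply/minsP/minsP => h i; have := h i; rewrite !E; lra.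
Qed.

Lemma mins_scale c (k : R) : 0 < k -> mins (fun j => k * c j) = mins c.
Proof.
by move=> k0; apply/setP => j; apply/minsP/minsP => h i; have := h i; rewrite ler_pM2l.
Qed.

(** Distinct [J] give disjoint sets: [c] is determined by the point up to a constant, which does not
    affect the minimizers. *)
Definition stratum J : set 'rV[R]_m := [set b | exists2 c, b = comb c & mins c = J].

Lemma stratum_comb J c : stratum J (comb c) <-> mins c = J.
Proof.
split=> [[d /comb_inj[k E] <-]|<-]; first exact: mins_shift E.
by exists c.
Qed.

Lemma stratumT : stratum [set: 'I_m.+1]%SET = [set 0].
Proof.
apply/seteqP; split=> [_ [c -> cT]|_ ->].
  rewrite /= -(comb_const (c 0)); apply: eq_bigr => j _; congr (_ *: _).
  have /minsP hj : j \in mins c by rewrite cT inE.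
  have /minsP h0 : 0 \in mins c by rewrite cT inE.
  by apply/eqP; rewrite eq_le hj h0.
exists (fun=> 0); first by rewrite comb_const.
by apply/setP => j; rewrite !inE; apply/forallP.
Qed.

Lemma sum_set_comb I c :
  \sum_(i in I) c i *: w i = comb (fun i => if i \in I then c i else 0).
Proof.
rewrite big_mkcond /comb; apply: eq_bigr => i _.
by case: ifP => //; rewrite scale0r.
Qed.

(** Once the minimum is shifted to 0, the coefficients are positive exactly off the minimizers;
    normalizing their sum gives a point of the open simplex. *)
Lemma open_cone_stratum I : I != finset.set0 -> I != [set: 'I_m.+1]%SET ->
  open_cone (open_simplex w I) = stratum (~: I).
Proof.
move=> I0 IT; have [j0 j0I] : exists j, j \notin I.
  move: IT; rewrite -finset.subTset => /fintype.subsetPn[j _ jI].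
  by exists j.
apply/seteqP; split=> [_ [t /= t0 [_ [c [c0 _] <-] <-]]|_ [c -> cI]].
  rewrite sum_set_comb -combZ; apply/stratum_comb.
  apply/setP => j; rewrite [RHS]inE; apply/minsP/idP => [h|/negbTE jI i].
    apply/negP => jI; have := h j0; rewrite jI (negbTE j0I) mulr0.
    by rewrite pmulr_rle0 // leNgt c0.
  by rewrite jI mulr0; case: ifP => [iI|_]; rewrite ?mulr0 // mulr_ge0 ?ltW ?c0.
have min_j j : j \notin I -> c j = c j0.
  move=> jI; apply/eqP; rewrite eq_le.
  have /minsP -> : j \in mins c by rewrite cI inE.
  by have /minsP -> : j0 \in mins c by rewrite cI inE.
pose c' j := c j - c j0.
have c'0 j : j \in I -> 0 < c' j.
  move=> jI; rewrite subr_gt0 ltNge; apply/negP => le_j.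
  have : j \in mins c.
    apply/minsP => i; apply: le_trans le_j _.
    by have /minsP -> : j0 \in mins c by rewrite cI inE.
  by rewrite cI inE jI.
have s0 : 0 < \sum_(i in I) c' i.
  have /finset.set0Pn[i iI] := I0; rewrite (bigD1 i) //=.
  by rewrite ltr_wpDr ?c'0 //; apply: sumr_ge0 => j /andP[jI _]; rewrite ltW ?c'0.
exists (\sum_(i in I) c' i) => //.
exists (\sum_(i in I) (c' i / \sum_(i in I) c' i) *: w i).
  exists (fun i => c' i / \sum_(i in I) c' i) => //; split.
    by move=> i iI; rewrite divr_gt0 ?c'0.
  by rewrite -mulr_suml divff ?gt_eqF.
rewrite sum_set_comb -combZ -[RHS]addr0 -(comb_const (- c j0)) -combD.
apply: eq_bigr => j _; congr (_ *: _); case: ifP => [jI|/negbT/min_j ->].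
  by rewrite mulrC mulfVK ?gt_eqF.
by rewrite mulr0 subrr.
Qed.

(** Dimension at most m - 2 means at most m - 1 of the m + 1 vertices, so at least two are
    missing. *)
Lemma skel_indexE I :
  @skel_index m (m%:Z - 2) I <-> I != finset.set0 /\ (2 <= #|~: I|)%N.
Proof.
rewrite /skel_index /= card_gt0; have := cardsC I; rewrite card_ord => cE.
by split=> -[-> h]; split=> //; move: cE h; move: #|_| #|_| => p q; lia.
Qed.

Lemma arboreal_strataE :
  arboreal_strata w = [set stratum J | J in [set J : {set 'I_m.+1} | (2 <= #|J|)%N]].
Proof.
apply/seteqP; split=> [_ [->|[I /skel_indexE[I0 cI] <-]]|_ [J /= cJ <-]].
- by exists [set: 'I_m.+1]%SET; rewrite ?stratumT //= cardsT card_ord.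
- exists (~: I) => //; rewrite open_cone_stratum //.
  by apply: contraTneq cI => ->; rewrite finset.setCT cards0.
have [->|JT] := eqVneq J [set: 'I_m.+1]%SET; first by left; rewrite stratumT.
right; exists (~: J).
  apply/skel_indexE; rewrite finset.setCK; split=> //.
  by apply: contra_neq JT => /(congr1 (fun I => ~: I)); rewrite finset.setCK finset.setC0.
rewrite open_cone_stratum ?finset.setCK //.
  by apply: contra_neq JT => /(congr1 (fun I => ~: I)); rewrite finset.setCK finset.setC0.
apply: contraTneq cJ => /(congr1 (fun I => ~: I)).
by rewrite finset.setCK finset.setCT => ->; rewrite cards0.
Qed.

(** Induction on [I]: the normalized sum is a binary convex combination of one vertex and the
    normalized sum of the others. *)
Lemma convex_set_sum (K : set 'rV[R]_m) I c :
  @convex_set R 'rV[R]_m K -> (forall i, i \in I -> K (w i)) ->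
  (forall i, i \in I -> 0 < c i) -> I != finset.set0 ->
  0 < \sum_(i in I) c i /\
  K ((\sum_(i in I) c i)^-1 *: \sum_(i in I) c i *: w i).
Proof.
move=> cK; have [N] := ubnP #|I|; elim: N I => // N IH I.
rewrite ltnS => IN KI c0 /finset.set0Pn[i iI].
have [ci0 Ki] := (c0 _ iI, KI _ iI).
have cD := cardsD1 i I; rewrite iI in cD.
have split_i (V : nmodType) (F : 'I_m.+1 -> V) :
    \sum_(j in I) F j = F i + \sum_(j in I :\ i) F j.
  by rewrite (bigD1 i) //=; congr (_ + _); apply: eq_bigl => j; rewrite !inE andbC.
rewrite !split_i; have [->|Ii] := eqVneq (I :\ i) finset.set0.
  by rewrite !big_set0 !addr0 scalerA mulVf ?gt_eqF // scale1r.
have [||||A0 KA] := IH (I :\ i); rewrite ?(leq_trans _ IN) ?cD //.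
- by move=> j; rewrite inE => /andP[_ /KI].
- by move=> j; rewrite inE => /andP[_ /c0].
have s0 := addr_gt0 ci0 A0; split=> //.
set A := \sum_(j in I :\ i) c j in A0 KA s0 *.
set X := \sum_(j in I :\ i) c j *: w j in KA *.
have := convex_set_combination (t := c i / (c i + A)) cK Ki KA.
rewrite divr_ge0 ?(ltW ci0) ?(ltW s0) // ler_pdivrMr // mul1r lerDl (ltW A0).
move=> /(_ isT isT).
have -> : 1 - c i / (c i + A) = A / (c i + A).
  by rewrite -{1}(divff (lt0r_neq0 s0)) -mulrBl addrAC subrr add0r.
by rewrite scalerA mulrAC divff ?gt_eqF // mul1r scalerDr scalerA mulrC.
Qed.

Lemma conv_hull_comb I b : conv_hull [set w i | i in [set i | i \in I]] b ->
  exists c, [/\ b = comb c, forall j, 0 <= c j & forall j, j \notin I -> c j = 0].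
Proof.
move: b; apply: smallest_sub => [x y t|_ [i /= iI <-]].
  rewrite !inE => -[c [-> c0 cI]] [d [-> d0 dI]].
  exists (fun j => t%:num * c j + (1 - t%:num) * d j); split=> [|j|j jI].
  - by rewrite combD !combZ.
  - by rewrite addr_ge0 ?mulr_ge0 ?subr_ge0.
  by rewrite cI // dI // !mulr0 addr0.
exists (fun j => (j == i)%:R); split=> [|j|j]; rewrite ?ler0n //.
  rewrite /comb (bigD1 i) //= eqxx scale1r big1 ?addr0 // => j /negbTE ->.
  by rewrite scale0r.
by move=> jI; case: eqVneq => // ji; rewrite ji iI in jI.
Qed.

Lemma arborealE :
  arboreal w = \bigcup_(J in [set J : {set 'I_m.+1} | (2 <= #|J|)%N]) stratum J.
Proof.
have T2 : (2 <= #|[set: 'I_m.+1]%SET|)%N by rewrite cardsT card_ord.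
apply/seteqP; split=> b.
  case=> [->|[t /= t0 [_ [I /skel_indexE[I0 cI] /conv_hull_comb[c [-> c0 cI0]]] <-]]].
    by exists [set: 'I_m.+1]%SET => //; rewrite stratumT.
  (* The coefficients are nonnegative and vanish off [I], so the missing vertices, at least two, are
     all minimizers. *)
  exists (mins (fun j => t * c j)); last by rewrite -combZ; apply/stratum_comb.
  apply: leq_trans cI _; apply: subset_leq_card; apply/fintype.subsetP => j.
  by rewrite inE => /cI0 cj; apply/minsP => i; rewrite cj mulr0 mulr_ge0.
case=> J /= cJ.
have [->|JT] := eqVneq J [set: 'I_m.+1]%SET; first by rewrite stratumT; left.
have I0 : ~: J != finset.set0.
  by apply: contra_neq JT => /(congr1 (fun I => ~: I)); rewrite finset.setCK finset.setC0.
have IT : ~: J != [set: 'I_m.+1]%SET.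
  apply: contraTneq cJ => /(congr1 (fun I => ~: I)).
  by rewrite finset.setCK finset.setCT => ->; rewrite cards0.
rewrite -[J]finset.setCK -open_cone_stratum // => -[t /= t0 [x [c [c0 c1] <-] <-]].
right; exists t; first exact: ltW.
exists (\sum_(i in ~: J) c i *: w i) => //; exists (~: J).
  by apply/skel_indexE; rewrite finset.setCK.
move=> K [cK KI]; have [|_] := convex_set_sum cK _ c0 I0.
  by move=> i iI; apply: KI; exists i.
by rewrite c1 invr1 scale1r.
Qed.
End ArborealStrata.

(** * The local homeomorphism *)

Lemma subr_continuous (R : realType) (V : normedModType R) (p : V) :
  continuous (fun x => x - p).
Proof. by move=> x; apply: cvgB; [exact: cvg_id|exact: cvg_cst]. Qed.

Section RadialMap.
Variables (R : realType) (Z : normedModType R) (e : R).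
Hypothesis e_gt0 : 0 < e.
Implicit Types y z : Z.

(* [blowup] maps the open ball of radius [e] onto [Z], with inverse [shrink];
   both preserve rays from the origin. *)
Definition blowup z : Z := (e - `|z|)^-1 *: z.
Definition shrink y : Z := (e / (1 + `|y|)) *: y.

Let den_gt0 y : 0 < 1 + `|y|.
Proof. by rewrite ltr_pwDl. Qed.

Lemma norm_shrink y : `|shrink y| = e * `|y| / (1 + `|y|).
Proof. by rewrite normrZ gtr0_norm ?divr_gt0 // mulrAC. Qed.

Lemma norm_shrink_lt y : `|shrink y| < e.
Proof.
by rewrite norm_shrink ltr_pdivrMr // ltr_pM2l // ltrDr.
Qed.

Lemma shrinkK : cancel shrink blowup.
Proof.
move=> y; rewrite /blowup norm_shrink /shrink scalerA.
have -> : e - e * `|y| / (1 + `|y|) = e / (1 + `|y|).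
  by rewrite -{1}(mulfK (lt0r_neq0 (den_gt0 y)) e) -mulrBl mulrDr mulr1 addrK.
by rewrite mulVf ?scale1r // gt_eqF ?divr_gt0.
Qed.

Lemma blowupK z : `|z| < e -> shrink (blowup z) = z.
Proof.
move=> ze; have d0 : 0 < e - `|z| by rewrite subr_gt0.
rewrite /shrink normrZ gtr0_norm ?invr_gt0 // {1}/blowup scalerA.
have -> : 1 + (e - `|z|)^-1 * `|z| = e / (e - `|z|).
  by rewrite -{1}(mulVf (lt0r_neq0 d0)) -mulrDr subrK mulrC.
by rewrite invf_div mulrCA divff ?gt_eqF // mulr1 divff ?scale1r ?gt_eqF.
Qed.

Lemma blowup_continuous z : `|z| < e -> {for z, continuous blowup}.
Proof.
move=> ze; apply: (@cvgZ _ _ _ _ _ (fun z => (e - `|z|)^-1) id).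
  apply: cvgV; first by rewrite subr_eq0 gt_eqF.
  by apply: cvgB; [exact: cvg_cst|exact: norm_continuous].
exact: cvg_id.
Qed.

Lemma shrink_continuous : continuous shrink.
Proof.
move=> y; apply: (@cvgZ _ _ _ _ _ (fun y => e / (1 + `|y|)) id); last exact: cvg_id.
apply: cvgM; first exact: cvg_cst.
apply: cvgV; first by rewrite gt_eqF.
by apply: cvgD; [exact: cvg_cst|exact: norm_continuous].
Qed.
End RadialMap.

(** * Linear coordinates adapted to the face *)

Lemma linear_pair_continuous (R : realType) k m (V : normedModType R)
  (f : 'rV[R]_k * 'rV[R]_m -> V) : linear f -> continuous f.
Proof.
move=> lf; have fE z : f z = f (z.1, 0) + f (0, z.2).
  rewrite -[f (z.1, 0)]scale1r -lf; congr f.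
  rewrite [LHS]surjective_pairing.
  by congr pair; rewrite /= ?scaler0 ?add0r ?scale1r ?addr0.
have c1 : continuous (fun a : 'rV[R]_k => f (a, 0)).
  apply: linear_rV_continuous => t a b; rewrite -lf; congr f.
  by congr pair; rewrite /= scaler0 addr0.
have c2 : continuous (fun a : 'rV[R]_m => f (0, a)).
  apply: linear_rV_continuous => t a b; rewrite -lf; congr f.
  by congr pair; rewrite /= scaler0 addr0.
rewrite (funext fE) => z; apply: cvgD.
  by apply: (@cvg_comp _ _ _ fst (fun a => f (a, 0))); [exact: cvg_fst|exact: c1].
by apply: (@cvg_comp _ _ _ snd (fun a => f (0, a))); [exact: cvg_snd|exact: c2].
Qed.

(** The first block consists of coordinates of the projection to [W]. They determine a vector of
    [W], the kernel of [g], so the map is injective, and dimensions agree. *)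
Lemma linear_iso_extension (R : realType) (n k m : nat) (W : {vspace 'rV[R]_n})
  (g : 'rV[R]_n -> 'rV[R]_m) :
  linear g -> \dim W = k -> (k + m)%N = n -> (forall x, g x = 0 <-> x \in W) ->
  exists (Phi : 'rV[R]_n -> 'rV[R]_k * 'rV[R]_m) 
         (Psi : 'rV[R]_k * 'rV[R]_m -> 'rV[R]_n),
    [/\ linear Phi, linear Psi, cancel Phi Psi, cancel Psi Phi &
        forall x, (Phi x).2 = g x].
Proof.
move=> lg dW kmn gW.
have [X basX] : exists X : k.-tuple 'rV[R]_n, basis_of W X.
  by rewrite -dW; exists (vbasis W); exact: vbasisP.
pose P x := (\row_i coord X i (projv W x), g x) : 'rV[R]_k * 'rV[R]_m.
have lP : linear P.
  move=> t x y; rewrite /P lg; congr pair.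
  by apply/rowP => i; rewrite !mxE !linearP.
pose Q : {linear 'rV[R]_n -> ('rV[R]_k * 'rV[R]_m)%type} :=
  HB.pack P (GRing.isLinear.Build R 'rV[R]_n ('rV[R]_k * 'rV[R]_m)%type *:%R P lP).
pose h := linfun Q.
have hE x : h x = P x by rewrite lfunE.
have ker0 : lker h == 0%VS.
  rewrite -subv0; apply/subvP => x; rewrite memv_ker hE memv0 => /eqP[cx /gW xW].
  rewrite -(projv_id xW) (coord_basis basX (memv_proj W x)) big1 // => i _.
  by have /rowP/(_ i) := cx; rewrite !mxE => ->; rewrite scale0r.
have imh : limg h = fullv.
  apply/eqP; rewrite eqEdim subvf /=; have := limg_ker_dim h fullv.
  rewrite (eqP ker0) capv0 dimv0 add0n => ->; rewrite !dimvf.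
  rewrite (_ : dim ('rV[R]_k * 'rV[R]_m)%type = (1 * k + 1 * m)%N) //.
  by rewrite dim_matrix; lia.
exists h, (h^-1)%VF; split.
- exact: linearP.
- exact: linearP.
- exact: lker0_lfunK.
- by move=> z; apply: limg_lfunVK; rewrite imh memvf.
by move=> x; rewrite hE.
Qed.

Lemma enumerate_set (T : finType) (A : {set T}) k : #|A| = k ->
  exists f : 'I_k -> T, injective f /\ forall x, x \in A <-> exists i, x = f i.
Proof.
move=> <-; exists enum_val; split; first exact: enum_val_inj.
move=> x; split=> [xA|[i ->]]; last exact: enum_valP.
by exists (enum_rank_in xA x); rewrite enum_rankK_in.
Qed.

(** Tested on lam a - lam b with [a] in [S] but not in [S'] and [b] outside [S]. The full set is
    excluded since its vector is 0, like that of the empty set. *)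
Lemma vecS_sub (R : realType) n (S S' : {set 'I_n.+1}) :
  S != [set: 'I_n.+1]%SET -> vecS R S = vecS R S' -> S \subset S'.
Proof.
move=> ST E; apply/fintype.subsetP => a aS; apply/negPn/negP => aS'.
have [b bS] : exists b, b \notin S.
  by move: ST; rewrite -finset.subTset => /fintype.subsetPn[b _ bS]; exists b.
have E' : vecS R S + vecS R finset.set0 = vecS R S' by rewrite vecS0 addr0.
have := hgt_vecS_lin (qd (fun c => (c == a)%:R - (c == b)%:R)) E'.
rewrite hgt0 addr0 !hgt_diff aS (negbTE aS') (negbTE bS).
by case: (b \in S') => /=; lra.
Qed.

Section LocalModel.
Variables (R : realType) (n m : nat) (p l0 : 'rV[R]_n).
Hypothesis cl0 : cells p l0.
Hypothesis card_tight : #|ptight l0 p| = m.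

(** The empty set is added as the index of [l0], giving m + 1 functions; the sign turns maximal
    heights into minima, as in the description of the arboreal cone. *)
Lemma ptight_frame :
  exists f : 'I_m.+1 -> {set 'I_n.+1},
    [/\ exists j, f j = finset.set0, injective (fun j => l0 + vecS R (f j)),
        forall x : 'rV[R]_n, (forall j, hgt (f j) x = 0) <->
          (forall S, S \in ptight l0 p -> hgt S x = 0) &
        \forall x \near p, forall l, cells x l <->
          exists2 j, j \in mins (fun i => - hgt (f i) (x - p)) & l = l0 + vecS R (f j)].
Proof.
set TT := (finset.set0 |: ptight l0 p)%SET.
have n0 : finset.set0 \notin ptight l0 p by rewrite inE /proper_set eqxx.
have cTT : #|TT| = m.+1 by rewrite cardsU1 n0 card_tight add1n.
have [f [f_inj fE]] := enumerate_set cTT.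
have fTT j : f j \in TT by apply/fE; exists j.
exists f; split.
- by have /fE[j ->] := setU11 finset.set0 (ptight l0 p); exists j.
- move=> i j /addrI E; apply: f_inj; apply/eqP.
  have nT k : f k != [set: 'I_n.+1]%SET.
    have := fTT k; rewrite finset.in_setU finset.in_set1 => /orP[/eqP->|].
      by apply/eqP => /setP/(_ ord0); rewrite !inE.
    by move=> /ptightP[/andP[]].
  by rewrite finset.eqEsubset (vecS_sub (nT i) E) (vecS_sub (nT j) (esym E)).
- move=> x; split=> h.
    move=> S tS; have /fE[j ->] // : S \in TT by rewrite finset.in_setU tS orbT.
  move=> j; have := fTT j; rewrite finset.in_setU finset.in_set1.
  by move=> /orP[/eqP->|/h //]; rewrite hgt0.
apply: near_sub (local_cells cl0) => x hx l; rewrite hx.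
split=> [[S [/fE[j ->] -> maxj]]|[j /minsP minj ->]].
  by exists j => //; apply/minsP => i; rewrite lerN2; exact: maxj.
by exists (f j); split=> // S /fE[i ->]; have := minj i; rewrite lerN2.
Qed.
End LocalModel.

(** * Assembly of the stratified homeomorphism near [p] *)

Theorem proposition1p2p1 (R : realType) (n m : nat)
    (w : 'I_m.+1 -> 'rV[R]_m) (F : set 'rV[R]_n) (p : 'rV[R]_n) :
  (1 <= m)%N -> (m <= n)%N ->
  affinely_independent w -> barycenter w = 0 ->
  honeycomb_face F -> aff_dim F (n - m) -> relint F p ->
  exists N : set 'rV[R]_n,
    open_nbhs p N /\
    let U := honeycomb R n `&` N in
    stratified_homeomorphic
      U (restrict_strata (honeycomb_strata R n) U)
      ([set: 'rV[R]_(n - m)] `*` arboreal w)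
      [set [set: 'rV[R]_(n - m)] `*` T | T in arboreal_strata w].
Proof.
move=> m0 mn w_free w_bary hF [x0 [W [dW affF]]] Fp.
have [l0 [cl0 _ FE]] := honeycomb_face_relint hF Fp.
have Pp : cell l0 p by case: cl0.
have WE x : x \in W <-> forall S, S \in ptight l0 p -> hgt S x = 0.
  have affE y : (forall S, S \in ptight l0 p -> hgt S (y - p) = 0) <->
      exists2 v, v \in W & x0 + v = y.
    by have := congr1 (@^~ y) affF; rewrite FE aff_hull_face //= => ->.
  have [|w0 Ww0 w0E] := (affE p).1; first by move=> S _; rewrite subrr linear0.
  split=> [Wx S tS|tx].
    have := (affE (p + x)).2; rewrite addrAC subrr add0r; apply=> //.
    by exists (w0 + x); rewrite ?memvD // addrA w0E.
  have [|v Wv vE] := (affE (p + x)).1; first by rewrite addrAC subrr add0r.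
  have -> : x = v - w0.
    by apply: (addrI p); rewrite -vE -w0E [RHS]addrACA subrr addr0.
  by rewrite memvB.
(* The tight sets form a chain, so their functionals are independent and their number is the
   codimension of [W]. *)
have card_tight : #|ptight l0 p| = m.
  have : (\dim W + #|ptight l0 p|)%N = n.
    apply: (@dim_chain_ker R n _ (fun i : 'I_#|ptight l0 p| => enum_val i)).
    - exact: enum_val_inj.
    - by move=> i; have /ptightP[] := enum_valP i.
    - move=> i j; have /ptightP[_ ti] := enum_valP i; have /ptightP[_ tj] := enum_valP j.
      exact: tight_chain Pp ti tj.
    move=> x; rewrite WE; split=> h; first by move=> i; apply: h; exact: enum_valP.
    by move=> S tS; rewrite -(enum_rankK_in tS tS).
  by rewrite dW; move: #|_| => k; lia.
have [f [[j0 f0] f_inj f_ker f_near]] := ptight_frame cl0 card_tight.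
pose u x j := - hgt (f j) x : R.
pose g x := comb w (u x).
have lg : linear g.
  move=> t x y; rewrite /g -combZ -combD; apply: eq_bigr => j _.
  by rewrite /u linearP opprD mulrN.
have gW x : g x = 0 <-> x \in W.
  rewrite WE -f_ker; split=> [g0 j|h]; last first.
    by rewrite /g -(comb_const w_bary 0); apply: eq_bigr => j _; rewrite /u h oppr0.
  have [k ku] := comb_inj w_free w_bary (etrans g0 (esym (comb_const w_bary 0))).
  (* [u x] is constant, and its entry at the empty set is 0. *)
  have := ku j0; rewrite /u f0 hgt0 oppr0 add0r => k0.
  by have := ku j; rewrite -k0 /u addr0 => /eqP; rewrite oppr_eq0 => /eqP.
have [Phi [Psi [lPhi lPsi PhiK PsiK Phi2]]] :=
  linear_iso_extension lg dW (subnK mn) gW.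
have cPhi : continuous Phi by exact: linear_rV_continuous.
have cPsi : continuous Psi by exact: linear_pair_continuous.
pose Z := ('rV[R]_(n - m) * 'rV[R]_m)%type.
have Phi0 : Phi 0 = 0 by have := lPhi (-1) 0 0; rewrite scaler0 addr0 scaleN1r addNr.
have Psi0 : Psi 0 = 0 by rewrite -Phi0 PhiK.
have [e e0 near_e] : exists2 e : R, 0 < e & forall z : Z, `|z| < e ->
    forall l, cells (p + Psi z) l <->
    exists2 j, j \in mins (u (p + Psi z - p)) & l = l0 + vecS R (f j).
  have c : (p + Psi z) @[z --> (0 : Z)] --> p.
    rewrite -[X in _ --> X]addr0 -Psi0.
    by apply: cvgD; [exact: cvg_cst|exact: cPsi].
  have /nbhs_ballP[e /= e0 He] := c _ f_near.
  by exists e => // z ze; apply: He; rewrite -ball_normE /= sub0r normrN.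
(* A ball in the linear coordinates, small enough for the local description of the cells; [blowup]
   maps it onto the whole space. *)
pose N := [set x | `|Phi (x - p)| < e].
pose J x := mins (u (x - p)).
have cellsN x : N x -> forall l, cells x l <->
    exists2 j, j \in J x & l = l0 + vecS R (f j).
  by move=> Nx; have := near_e _ Nx; rewrite PhiK addrC subrK.
have honeyN x : N x -> honeycomb R n x <-> (2 <= #|J x|)%N.
  move=> Nx; rewrite honeycombE; split.
    move=> [_ [_ [/(cellsN _ Nx)[i iJ ->] /(cellsN _ Nx)[j jJ ->] ij]]].
    by apply/card_gt1P; exists i, j; split=> //; apply: contra_notN ij => /eqP->.
  move=> /card_gt1P[i [j [iJ jJ ij]]].
  exists (l0 + vecS R (f i)), (l0 + vecS R (f j)); split.
  - by apply/cellsN => //; exists i.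
  - by apply/cellsN => //; exists j.
  by move=> /f_inj /eqP; rewrite (negbTE ij).
have eq_cellsN x y : N x -> N y -> cells y = cells x <-> J y = J x.
  move=> Nx Ny; split=> [E|E].
    apply/setP => j; apply/idP/idP => jJ.
      have /(cellsN _ Nx)[i iJ /f_inj ->//] : cells x (l0 + vecS R (f j)).
      by rewrite -E; apply/(cellsN _ Ny); exists j.
    have /(cellsN _ Ny)[i iJ /f_inj ->//] : cells y (l0 + vecS R (f j)).
    by rewrite E; apply/(cellsN _ Nx); exists j.
  apply/seteqP; split=> l.
    by move=> /(cellsN _ Ny); rewrite E => h; exact/(cellsN _ Nx).
  by move=> /(cellsN _ Nx); rewrite -E => h; exact/(cellsN _ Ny).
pose phi x : Z := blowup e (Phi (x - p)).
pose psi y : 'rV[R]_n := p + Psi (shrink e y).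
have psiE y : Phi (psi y - p) = shrink e y.
  by rewrite /psi addrAC subrr add0r PsiK.
have Npsi y : N (psi y) by rewrite /N /= psiE norm_shrink_lt.
have psiK y : phi (psi y) = y by rewrite /phi psiE shrinkK.
have phiK x : N x -> psi (phi x) = x.
  by move=> Nx; rewrite /psi /phi blowupK // PhiK addrC subrK.
(* On [N] the radial map multiplies [u] by a positive factor, which keeps the minimizers. *)
have phi_stratum x K : N x -> stratum w K (phi x).2 <-> J x = K.
  move=> Nx; rewrite /phi /blowup /= Phi2 /g -combZ stratum_comb //.
  by rewrite mins_scale // invr_gt0 subr_gt0.
have arbE := arborealE m0 w_free w_bary.
have stratE := arboreal_strataE m0 w_free w_bary.
exists N; split.
  split; last by rewrite /N /= subrr Phi0 normr0.
  have -> : N = (fun x => `|Phi (x - p)|) @^-1` [set t | t < e] by [].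
  apply: open_comp; last exact: open_lt.
  move=> x _; apply: (@cvg_comp _ _ _ (fun x => Phi (x - p)) (fun z => `|z|));
    last exact: norm_continuous.
  apply: (@cvg_comp _ _ _ (fun x => x - p) Phi); last exact: cPhi.
  exact: subr_continuous.
exists phi, psi; split.
- split.
  + move=> x [hx Nx]; split=> //; rewrite arbE; exists (J x); last exact/phi_stratum.
    exact/honeyN.
  + move=> x y; rewrite !inE => -[_ Nx] [_ Ny] E.
    by rewrite -(phiK _ Nx) -(phiK _ Ny) E.
  move=> y [_]; rewrite arbE => -[K /= cK yK]; exists (psi y) => //.
  split=> //; apply/honeyN => //.
  by have /phi_stratum -> : stratum w K (phi (psi y)).2 by rewrite psiK.
- by move=> x; rewrite inE => -[_ Nx]; exact: phiK.
- apply: continuous_in_subspaceT => x; rewrite inE => -[_ Nx].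
  apply: (@cvg_comp _ _ _ (fun x => Phi (x - p)) (blowup e));
    last exact: blowup_continuous.
  apply: (@cvg_comp _ _ _ (fun x => x - p) Phi); last exact: cPhi.
  exact: subr_continuous.
- apply: continuous_subspaceT => y; apply: cvgD; first exact: cvg_cst.
  apply: (@cvg_comp _ _ _ (shrink e) Psi); first exact: shrink_continuous.
  exact: cPsi.
have imE x G : N x -> honeycomb_face G -> relint G x ->
    phi @` (relint G `&` (honeycomb R n `&` N)) =
    [set: 'rV[R]_(n - m)] `*` stratum w (J x).
  move=> Nx hG Gx; have [_ GE] := relint_honeycomb_face hG Gx.
  have [hx _] := relint_honeycomb_face hG Gx.
  apply/seteqP; split=> [_ [y [Gy [_ Ny]] <-]|y [_ yJ]].
    split=> //; apply/phi_stratum => //; apply/eq_cellsN => //.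
    by move: Gy; rewrite GE.
  have Jy : J (psi y) = J x by apply/phi_stratum => //; rewrite psiK.
  exists (psi y) => //; split; last first.
    by split=> //; apply/honeyN => //; rewrite Jy; apply/honeyN.
  by rewrite GE /=; apply/eq_cellsN.
apply/seteqP; split=> [_ [_ [_ [[G hG <-] [x [Gx [hx Nx]]]] <-] <-]|_ [T T_strat <-]].
  rewrite (imE x) //; exists (stratum w (J x)) => //.
  by rewrite stratE; exists (J x) => //=; apply/honeyN.
move: T_strat; rewrite stratE => -[K /= cK <-].
(* A point of the given stratum: the coefficients are 0 on the nonempty [K] and 1 elsewhere. Its
   preimage lies in the honeycomb stratum sought. *)
pose y : Z := (0, comb w (fun j => (j \notin K)%:R)).
have yK : stratum w K y.2.
  apply/stratum_comb => //; apply/setP => j.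
  have [i iK] : exists i, i \in K by apply/finset.set0Pn; rewrite -card_gt0 ltnW.
  apply/minsP/idP => [/(_ i)|jK k]; last by rewrite jK ler0n.
  by rewrite iK; case: (j \in K) => //=; rewrite ler10.
have Jy : J (psi y) = K by apply/phi_stratum => //; rewrite psiK.
have hy : honeycomb R n (psi y) by apply/honeyN => //; rewrite Jy.
have [G hG Gy] := honeycomb_face_exists hy.
exists (relint G `&` (honeycomb R n `&` N)); last by rewrite (imE (psi y)) // Jy.
exists (relint G) => //; split; first by exists G.
by exists (psi y).
Qed.
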